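(* Let $\omega$ be a modulus of continuity (not identically zero) and $X$ an isotropic $L$-space. For all $t\in[a,b]$, all non-negative $\gamma_1,\gamma_2,h_1,h_2$ such that $$\gamma_1+\gamma_2>0,\quad h_1+h_2>0,\quad [t-\gamma_1,t+\gamma_2]\subset[t-h_1,t+h_2]\subset[a,b],$$ and all $f\in\overline W^1H^\omega([a,b],X)$, $$\|\Delta^H_{\gamma_1,\gamma_2}f(t)\|_X\le K(\gamma_1,\gamma_2;h_1,h_2)\,\|\mathcal D_Hf\|_{\omega,X}+\|\Delta^H_{h_1,h_2}f(t)\|_X,$$ $$\|\mathcal D_Hf(t)\|_X\le\frac{I(h_1)+I(h_2)}{h_1+h_2}\,\|\mathcal D_Hf\|_{\omega,X}+\|\Delta^H_{h_1,h_2}f(t)\|_X.$$ The inequality $\|\Delta^H_{\gamma_1,\gamma_2}f(t)\|_X\le K(\gamma_1,\gamma_2;h_1,h_2)\,\|\mathcal D_Hf\|_{\omega,X}+\|\Delta^H_{h_1,h_2}f(t)\|_X$ is sharp for concave $\omega$. The inequality $\|\mathcal D_Hf(t)\|_X\le\frac{I(h_1)+I(h_2)}{h_1+h_2}\,\|\mathcal D_Hf\|_{\omega,X}+\|\Delta^H_{h_1,h_2}f(t)\|_X$ is sharp for arbitrary $\omega$. (Sharp means: for the given $t$ and parameters there is $f\in\overline W^1H^\omega([a,b],X)$ with $\|\mathcal D_Hf\|_{\omega,X}\neq0$ for which equality holds.)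
   Context: A modulus of continuity is a non-decreasing continuous semi-additive function $\omega\colon[0,\infty)\to[0,\infty)$ (i.e. $\omega(s+t)\le\omega(s)+\omega(t)$) with $\omega(0)=0$. $I(\alpha)=\int_0^\alpha\omega(s)\,ds$, and $$K(\gamma_1,\gamma_2;h_1,h_2)=\frac{(h_1-\gamma_1)+(h_2-\gamma_2)}{(h_1+h_2)^2}\left\{I\left(\tfrac{(h_1+h_2)(h_1-\gamma_1)}{(h_1-\gamma_1)+(h_2-\gamma_2)}\right)+I\left(\tfrac{(h_1+h_2)(h_2-\gamma_2)}{(h_1-\gamma_1)+(h_2-\gamma_2)}\right)\right\}$$ (understood as $0$ if $h_1=\gamma_1$ and $h_2=\gamma_2$). A semilinear space is a set $X$ with addition and multiplication by real numbers such that for all $x,y,z\in X$, $\alpha,\beta\in\mathbb R$: $x+y=y+x$; $x+(y+z)=(x+y)+z$; there is $\theta\in X$ with $x+\theta=x$ for all $x$; $\alpha(x+y)=\alpha x+\alpha y$; $\alpha(\beta x)=(\alpha\beta)x$; $1\cdot x=x$, $0\cdot x=\theta$. An $L$-space is a semilinear space $X$ with a complete separable metric $h_X$ such that $h_X(\alpha x,\alpha y)=|\alpha|h_X(x,y)$ and $h_X(x+z,y+z)\le h_X(x,y)$; it is isotropic if the last inequality is always an equality. An element $x$ is convex if $(\alpha+\beta)x=\alpha x+\beta x$ for all $\alpha,\beta\ge0$; $X^{\rm c}$ is the set of convex elements. An element $x$ is invertible if there is $x'\in X$ with $x+x'=\theta$; $X^{\rm inv}$ is the set of invertible elements. Standing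 assumption: $X^{\rm inv}\cap X^{\rm c}\ne\{\theta\}$. $X$ is equipped with a fixed convexifying operator $P$: a surjection $P\colon X\to X^{\rm c}$ with $h_X(P(x),P(y))\le h_X(x,y)$, $P\circ P=P$, $P(\alpha x+\beta y)=\alpha P(x)+\beta P(y)$ for all $x,y\in X$, $\alpha,\beta\in\mathbb R$. Integral: for a simple mapping $f$ taking values $f_1,\dots,f_n$ on pairwise disjoint measurable sets $T_1,\dots,T_n$, $\int f(s)\,ds:=\sum_iP(f_i)\mu(T_i)$ ($\mu$ the Lebesgue measure); for a uniform limit $f$ of simple mappings $f^k$ (in particular for continuous $f$), $\int f:=\lim_k\int f^k$. Hukuhara type difference: $z=x-_Hy$ means $x=y+z$ (unique, if it exists, in an isotropic space). $f$ has Hukuhara type derivative $\mathcal D_Hf(t)$ at $t\in(a,b)$ if for all small $\gamma>0$ the differences $f(t+\gamma)-_Hf(t)$, $f(t)-_Hf(t-\gamma)$ exist and the limits as $\gamma\to+0$ of $\gamma^{-1}(f(t+\gamma)-_Hf(t))$ and $\gamma^{-1}(f(t)-_Hf(t-\gamma))$ exist and coincide; $\mathcal D_Hf(t)$ is the common limit (one-sided at $t=a,b$). Divided difference: $\Delta^H_{\gamma_1,\gamma_2}f(t)=\frac{1}{\gamma_1+\gamma_2}\bigl(f(t+\gamma_2)-_Hf(t-\gamma_1)\bigr)$. $H^\omega([a,b],X)$ is the class of $f\colon[a,b]\to X$ with $h_X(f(t'),f(t''))\le\omega(|t'-t''|)$ for all $t',t''\in[a,b]$. $W^1H^\omega([a,b],X)$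 is the class of functions $f(t)=x+\int_a^t\phi(s)\,ds$ with $\phi\in H^\omega([a,b],X)$, $x\in X^{\rm c}$; for such $f$, $\mathcal D_Hf=P(\phi)$. $\overline W^1H^\omega([a,b],X)=\bigcup_{k>0}k\cdot W^1H^\omega([a,b],X)$. Notation: $\|x\|_X=h_X(x,\theta)$, $\|f\|_{\omega,X}=\sup_{t'\ne t''\in[a,b]}\frac{h_X(f(t'),f(t''))}{\omega(|t'-t''|)}$. *)

(* Defs.v *)
From HB Require Import structures.
From mathcomp Require Import all_boot all_order all_algebra.
From mathcomp Require Import all_classical all_reals all_analysis.

Set Implicit Arguments.
Unset Strict Implicit.
Unset Printing Implicit Defensive.

Import Order.TTheory GRing.Theory Num.Theory.
Import numFieldNormedType.Exports.

Local Open Scope classical_set_scope.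
Local Open Scope ring_scope.

(* [nmodType] and [lSemiModType] are not reused: the library declares no common
   substructure of [nmodType] and [metricType], and [lSemiModType] requires
   (a + b) x = a x + b x for all scalars, an identity that characterizes only
   some elements here (see [convex_elements]). *)
HB.mixin Record isSemilinear (R : realType) X := {
  theta : X;
  sadd : X -> X -> X;
  sscale : R -> X -> X;
  saddC : forall x y, sadd x y = sadd y x;
  saddA : forall x y z, sadd x (sadd y z) = sadd (sadd x y) z;
  sadd0 : forall x, sadd x theta = x;
  sscaleDr : forall a x y, sscale a (sadd x y) = sadd (sscale a x) (sscale a y);
  sscaleA : forall a b x, sscale a (sscale b x) = sscale (a * b) x;
  sscale1 : forall x, sscale 1 x = x;
  sscale0 : forall x, sscale 0 x = theta
}.

#[short(type="semilinearType")]
HB.structure Definition Semilinear (R : realType) := {X of isSemilinear R X}.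

Arguments theta {R s}.

Notation "x +:: y" := (sadd x y) (at level 50, left associativity) :
  ring_scope.
Notation "a *:: x" := (sscale a x) (at level 40, left associativity) :
  ring_scope.

Section SemilinearMonoid.
Context (R : realType) (X : semilinearType R).

Let sadd_id : left_id (theta : X) sadd.
Proof. by move=> x; rewrite saddC sadd0. Qed.

HB.instance Definition _ :=
  Monoid.isComLaw.Build X theta sadd saddA saddC sadd_id.

End SemilinearMonoid.

HB.mixin Record isLSpace (R : realType) X
    of Semilinear R X & Metric R X & Complete X := {
  lspace_separable : exists2 D : set X, countable D & dense D;
  mdist_sscale : forall (a : R) (x y : X),
    mdist (a *:: x) (a *:: y) = `|a| * (mdist x y : R);
  mdist_addr_le : forall x y z : X,
    (mdist (x +:: z) (y +:: z) : R) <= mdist x y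
}.

#[short(type="lspaceType")]
HB.structure Definition LSpace (R : realType) :=
  {X of Semilinear R X & Metric R X & Complete X & isLSpace R X}.

Section LSpaceNotions.
Context (R : realType) (X : lspaceType R).
Implicit Types (x y : X) (P : X -> X) (f : R -> X) (w : R -> R) (a b t : R).

Definition isotropic : Prop :=
  forall x y z : X, (mdist (x +:: z) (y +:: z) : R) = mdist x y.

Definition convex_elements : set X :=
  [set x | forall a b : R, 0 <= a -> 0 <= b ->
             (a + b) *:: x = a *:: x +:: b *:: x].

Definition invertible_elements : set X := [set x | exists x', x +:: x' = theta].

Definition xnorm x : R := mdist x theta.

Record convexifying P : Prop := {
  convexifying_range : range P = convex_elements;
  convexifying_nonexpansive : forall x y,
    (mdist (P x) (P y) : R) <= mdist x y;
  convexifying_idem : forall x, P (P x) = P x;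
  convexifying_linear : forall (a b : R) x y,
    P (a *:: x +:: b *:: y) = a *:: P x +:: b *:: P y
}.

(* Lebesgue measurable sets, i.e. Caratheodory-measurable ones for the outer
   Lebesgue measure, not only the Borel ones. *)
Definition lebesgue_measurable (A : set R) : Prop :=
  (@wlength R idfun)^*%mu.-cara.-measurable A.

(* The sets T_i are the level sets of the simple mapping in D, for its finitely
   many distinct values f_i. *)
Definition simple_mapping (D : set R) f : Prop :=
  finite_set (f @` D) /\
  forall x, lebesgue_measurable (D `&` f @^-1` [set x]).

Definition simple_integral P (D : set R) f : X :=
  \big[sadd/theta]_(x \in f @` D)
    (fine (completed_lebesgue_measure (D `&` f @^-1` [set x])) *:: P x).

Definition is_lintegral P (D : set R) f (v : X) : Prop :=
  exists g : nat -> R -> X,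
    [/\ forall k, simple_mapping D (g k),
        {uniform D, g @ \oo --> f} &
        simple_integral P D (g k) @[k --> \oo] --> v].

(* Equal to theta when f is not a uniform limit of simple mappings on
   [[a, b]]; continuous mappings are always such limits. *)
Definition lintegral P a b f : X :=
  xget theta [set v | is_lintegral P `[a, b]%classic f v].

Definition is_hdiff x y (z : X) : Prop := x = y +:: z.

(* Equal to theta when the difference does not exist. *)
Definition hdiff x y : X := xget theta [set z | is_hdiff x y z].

Definition is_right_hderive f t (d : X) : Prop :=
  (\forall g \near 0^'+, exists z, is_hdiff (f (t + g)) (f t) z) /\
  (g^-1 *:: hdiff (f (t + g)) (f t) @[g --> 0^'+] --> d).

Definition is_left_hderive f t (d : X) : Prop :=
  (\forall g \near 0^'+, exists z, is_hdiff (f t) (f (t - g)) z) /\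
  (g^-1 *:: hdiff (f t) (f (t - g)) @[g --> 0^'+] --> d).

(* Derivative at a point t of [[a, b]]: two-sided inside, one-sided at the
   endpoints. *)
Definition is_hderive a b f t (d : X) : Prop :=
  (t < b -> is_right_hderive f t d) /\ (a < t -> is_left_hderive f t d).

(* Equal to theta when the derivative does not exist. *)
Definition hderive a b f t : X := xget theta [set d | is_hderive a b f t d].

Definition divided_hdiff (g1 g2 : R) f t : X :=
  (g1 + g2)^-1 *:: hdiff (f (t + g2)) (f (t - g1)).

(* Mappings [[a, b]] -> X are represented by mappings R -> X, whose values
   outside [[a, b]] are irrelevant. *)
Definition Homega w a b : set (R -> X) :=
  [set f | forall s s', s \in `[a, b] -> s' \in `[a, b] ->
             mdist (f s) (f s') <= w `|s - s'|].

Definition W1Homega P w a b : set (R -> X) :=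
  [set f | exists phi x,
    [/\ Homega w a b phi, convex_elements x &
        forall t, t \in `[a, b] -> f t = x +:: lintegral P a t phi]].

Definition W1Homega_bar P w a b : set (R -> X) :=
  [set f | exists k g,
    [/\ 0 < k, W1Homega P w a b g &
        forall t, t \in `[a, b] -> f t = k *:: g t]].

Definition omega_norm w a b f : \bar R :=
  ereal_sup [set (mdist (f s.1) (f s.2) / w `|s.1 - s.2|)%:E |
    s in [set s : R * R |
           [/\ s.1 \in `[a, b], s.2 \in `[a, b] & s.1 != s.2]]].

End LSpaceNotions.
Arguments isotropic {R} X.
Arguments convex_elements {R} X.
Arguments invertible_elements {R} X.

Section Moduli.
Context (R : realType).
Implicit Types (w : R -> R).

(* Moduli on [0, +oo[ are represented by functions R -> R; their values at
   negative arguments are irrelevant. *)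
Record modulus_of_continuity w : Prop := {
  modulus_ge0 : forall s, 0 <= s -> 0 <= w s;
  modulus_homo : forall s t, 0 <= s -> s <= t -> w s <= w t;
  modulus_continuous : {within `[0, +oo[, continuous w};
  modulus_semiadditive : forall s t, 0 <= s -> 0 <= t ->
    w (s + t) <= w s + w t;
  modulus0 : w 0 = 0
}.

Definition concave_modulus w : Prop :=
  convex_function (`[0, +oo[%classic : set (convex_lmodType R^o))
    (fun s => - w s).

Definition Iomega w (al : R) : R :=
  \int[lebesgue_measure]_(s in `[0, al]) w s.

(* If h1 = g1 and h2 = g2 the leading factor is 0, hence so is the value. *)
Definition Komega w (g1 g2 h1 h2 : R) : R :=
  ((h1 - g1) + (h2 - g2)) / (h1 + h2) ^+ 2 *
  (Iomega w ((h1 + h2) * (h1 - g1) / ((h1 - g1) + (h2 - g2))) +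
   Iomega w ((h1 + h2) * (h2 - g2) / ((h1 - g1) + (h2 - g2)))).

End Moduli.

(* Main.v *)
Require Import Defs.
From HB Require Import structures.
From mathcomp Require Import all_boot all_order all_algebra.
From mathcomp Require Import all_classical all_reals all_analysis.
From mathcomp Require Import finmap ring lra.

Set Implicit Arguments.
Unset Strict Implicit.
Unset Printing Implicit Defensive.

Import Order.TTheory GRing.Theory Num.Theory.
Import numFieldNormedType.Exports.

Local Open Scope classical_set_scope.
Local Open Scope ring_scope.

(* If f' = psi, then the divided differences of f are means of psi over the
   intervals U = [t - g1, t + g2] and V = [t - h1, t + h2], so by the triangle
   inequality the task is to bound the distance of two means (or of a mean and
   the value psi t).  Put G = |U|, H = |V| and S = H - G.  The common mass 1/H
   on U cancels because psi is convex-valued.  The mass of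
   V \ U left of U is transported linearly, with its order reversed, onto the
   initial part of U of length (h1 - g1) G / S, and symmetrically on the right;
   a point at distance v from U travels v H / S, which integrates to the kernel
   K times the omega-norm of psi.

   An invertible convex element of norm one spans an isometric additive copy
   of the real line, on which the extremal problem is scalar.  The tent
   C - omega|s - t| is extremal for the derivative.  For the divided difference
   one takes the minimum of two ramps, increasing from the left and decreasing
   to the right, for which every transported pair realizes omega exactly; it
   lies in H^omega by concavity. *)

(** X carries no subtraction, and its integral is only a limit of sums over level sets. Hence the
    common mass cannot be removed from the two means. It is kept, and the mass is balanced at each
    value instead: with [k = G / S] one has [(h * k) / G = (h * k + h) / H], and convexity of the
    value merges the two summands on the right. The transport is carried out without substitution in
    the integral: the length of the moved piece grows and increments are compared, which needs only
    additivity and a uniform first-order estimate. The two pieces of V \ U do not interfere, because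
    the lengths of their images add up to G.

    In both extremal examples a vertical shift makes the mean over V vanish. The omega-norm is only
    checked to be at most one; that it equals one follows from the inequality itself, whose left
    side is computed to be the full constant. *)

(** * Metric arithmetic in an L-space *)

Section LSpaceTheory.
Context (R : realType) (X : lspaceType R).
Implicit Types (x y z u v : X) (c : R).

Local Notation dist x y := (mdist (x : X) (y : X) : R).

Lemma sadd0l x : theta +:: x = x.
Proof. by rewrite saddC sadd0. Qed.

Lemma saddACA x y z u : (x +:: y) +:: (z +:: u) = (x +:: z) +:: (y +:: u).
Proof. by rewrite -!saddA (saddA y) (saddC y z) !saddA. Qed.

Lemma sscale_theta c : c *:: theta = theta :> X.
Proof. by rewrite -(sscale0 (theta : X)) sscaleA mulr0. Qed.

Lemma dist_addr_le x y z : dist (x +:: z) (y +:: z) <= dist x y.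
Proof. exact: mdist_addr_le. Qed.

Lemma dist_scale c x y : dist (c *:: x) (c *:: y) = `|c| * dist x y.
Proof. exact: mdist_sscale. Qed.

Lemma dist_scale_ge0 c x y : 0 <= c ->
  dist (c *:: x) (c *:: y) = c * dist x y.
Proof. by move=> c0; rewrite dist_scale ger0_norm. Qed.

Lemma dist_add_le x y z u :
  dist (x +:: y) (z +:: u) <= dist x z + dist y u.
Proof.
apply: (le_trans (metric_triangle _ (z +:: y) _)).
by rewrite lerD ?dist_addr_le// !(saddC z) dist_addr_le.
Qed.

Lemma xnorm_scale c x : 0 <= c -> xnorm (c *:: x) = c * xnorm x.
Proof.
by move=> c0; rewrite /xnorm -[X in mdist _ X](sscale_theta c) dist_scale_ge0.
Qed.

Lemma xnorm_le_dist x y : xnorm x <= dist x y + xnorm y.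
Proof. exact: metric_triangle. Qed.

Lemma theta_convex : convex_elements X theta.
Proof. by move=> a b _ _; rewrite !sscale_theta sadd0. Qed.

Lemma convex_scale c x : 0 <= c -> convex_elements X x ->
  convex_elements X (c *:: x).
Proof.
by move=> c0 xc a b a0 b0; rewrite !sscaleA mulrDl xc// mulr_ge0.
Qed.

Lemma dist_big_le (I : Type) (r : seq I) (F G : I -> X) :
  dist (\big[sadd/theta]_(i <- r) F i) (\big[sadd/theta]_(i <- r) G i) <=
  \sum_(i <- r) dist (F i) (G i).
Proof.
elim: r => [|i r ih]; first by rewrite !big_nil mdistxx.
by rewrite !big_cons (le_trans (dist_add_le _ _ _ _))// lerD.
Qed.

Section Isotropic.
Hypothesis iso : isotropic X.

(** In the isotropic case translations are isometries; this is what makes Hukuhara differences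
    unique. *)
Lemma sadd_injl x : injective (sadd x).
Proof.
by move=> y z e; apply: mdist_positivity; rewrite -(iso _ _ x) !(saddC _ x) e mdistxx.
Qed.

Lemma hdiff_eq x y z : x = y +:: z -> hdiff x y = z.
Proof.
move=> e; apply: xget_unique => // z'; rewrite /is_hdiff e.
by move/sadd_injl.
Qed.

End Isotropic.

Section Convexifying.
Variable P : X -> X.
Hypothesis cP : convexifying P.

Lemma convexifying_convex x : convex_elements X (P x).
Proof. by rewrite -(convexifying_range cP); exists x. Qed.

Lemma convexifying_id x : convex_elements X x -> P x = x.
Proof.
by rewrite -(convexifying_range cP) => -[y _ <-]; rewrite (convexifying_idem cP).
Qed.

End Convexifying.

End LSpaceTheory.

(** * Completed Lebesgue measure on bounded intervals *)

Section CompletedLebesgue.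
Context (R : realType).

Local Notation mu A := (fine (completed_lebesgue_measure A%classic)).

Lemma lebesgue_measurable_itv (i : interval R) : lebesgue_measurable [set` i].
Proof. by apply: sub_caratheodory; exact: measurable_itv. Qed.

Lemma lebesgue_measurableI (A B : set R) :
  lebesgue_measurable A -> lebesgue_measurable B -> lebesgue_measurable (A `&` B).
Proof. exact: measurableI. Qed.

Lemma lebesgue_measurableU (A B : set R) :
  lebesgue_measurable A -> lebesgue_measurable B -> lebesgue_measurable (A `|` B).
Proof. exact: measurableU. Qed.

Lemma lebesgue_measurable0 : lebesgue_measurable (set0 : set R).
Proof. exact: measurable0. Qed.

Lemma completed_itv (i : interval R) :
  completed_lebesgue_measure [set` i] = lebesgue_measure [set` i].
Proof. by []. Qed.

Lemma completed_fin (a b : R) (A : set R) : lebesgue_measurable A ->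
  A `<=` `[a, b] -> completed_lebesgue_measure A \is a fin_num.
Proof.
move=> mA sA; rewrite ge0_fin_numE ?measure_ge0//.
apply: (@le_lt_trans _ _ (completed_lebesgue_measure `[a, b])).
  by apply: le_measure => //; apply: mem_set => //; exact: lebesgue_measurable_itv.
rewrite completed_itv lebesgue_measure_itv /=.
by case: ifP => // _; rewrite ltry.
Qed.

Lemma fine_completed_itv (a b : R) : a <= b -> mu `[a, b] = b - a.
Proof.
move=> ab; rewrite completed_itv lebesgue_measure_itv /= lte_fin.
by case: ltP => //= ba; rewrite (@le_anti _ _ a b) ?ab// subrr.
Qed.

Lemma fine_completed_ge0 (A : set R) : 0 <= mu A.
Proof. by rewrite fine_ge0. Qed.

Lemma fine_completedU (a b : R) (A B : set R) :
  lebesgue_measurable A -> lebesgue_measurable B ->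
  A `<=` `[a, b] -> B `<=` `[a, b] -> A `&` B = set0 ->
  mu (A `|` B) = mu A + mu B.
Proof.
move=> mA mB sA sB AB0; rewrite -fineD ?(completed_fin _ sA) ?(completed_fin _ sB)//.
by rewrite measureU.
Qed.

(** The closed pieces overlap in [c]. Both sides are compared with the half-open piece ending at
    [c]; a single point has measure zero. *)
Lemma fine_completed_split (a b c : R) (A : set R) : a <= c -> c <= b ->
  lebesgue_measurable A ->
  mu (`[a, b] `&` A) = mu (`[a, c] `&` A) + mu (`[c, b] `&` A).
Proof.
move=> ac cb mA.
have mI (i : interval R) : lebesgue_measurable ([set` i] `&` A).
  by apply: lebesgue_measurableI => //; exact: lebesgue_measurable_itv.
have -> : `[a, b] `&` A = (`[a, c[ `&` A) `|` (`[c, b] `&` A).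
  rewrite -setIUl; congr (_ `&` _); apply/seteqP; split => s /=.
    by rewrite !in_itv /= => /andP[-> ->]; case: ltP => //; [left|right].
  by rewrite !in_itv /= => -[/andP[h1 h2]|/andP[h1 h2]]; apply/andP; split => //; lra.
have sub0 : `[a, c[ `&` A `<=` `[a, b].
  by move=> s []; rewrite /= !in_itv /= => /andP[h1 h2] _; apply/andP; split; lra.
have sub1 : `[c, b] `&` A `<=` `[a, b].
  by move=> s []; rewrite /= !in_itv /= => /andP[h1 h2] _; apply/andP; split; lra.
rewrite (@fine_completedU a b)//; last first.
  apply/seteqP; split => // s [[]]; rewrite /= !in_itv /= => /andP[_ sc] _ [/andP[cs _] _].
  by move: (lt_le_trans sc cs); rewrite ltxx.
congr (_ + _).
have -> : `[a, c] `&` A = (`[a, c[ `&` A) `|` (`[c, c] `&` A).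
  rewrite -setIUl; congr (_ `&` _); apply/seteqP; split => s /=.
    rewrite !in_itv /= => /andP[-> sc]; case: ltP => [|cs]; [by left|right].
    by apply/andP; split.
  by rewrite !in_itv /= => -[/andP[h1 h2]|/andP[h1 h2]]; apply/andP; split => //; lra.
rewrite (@fine_completedU a b)//.
- suff -> : mu (`[c, c] `&` A) = 0 by rewrite addr0.
  apply/eqP; rewrite eq_le fine_completed_ge0 andbT.
  rewrite -(subrr c) -(fine_completed_itv (lexx c)).
  apply: fine_le; [exact: (completed_fin _ (@subIsetl _ _ _))|
    exact: (completed_fin (lebesgue_measurable_itv _) (@subset_refl _ _))|].
  apply: le_measure; [apply: mem_set|apply: mem_set|exact: subIsetl].
    exact: mI.
  exact: lebesgue_measurable_itv.
- by move=> s []; rewrite /= !in_itv /= => /andP[h1 h2] _; apply/andP; split; lra.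
- apply/seteqP; split => // s [[]]; rewrite /= !in_itv /= => /andP[_ sc] _ [/andP[cs _] _].
  by move: (lt_le_trans sc cs); rewrite ltxx.
Qed.

End CompletedLebesgue.

(** * The integral of simple mappings *)

Section SimpleIntegral.
Context (R : realType) (X : lspaceType R) (P : X -> X).
Hypothesis cP : convexifying P.

Local Notation mu A := (fine (completed_lebesgue_measure A%classic)).
Local Notation dist x y := (mdist (x : X) (y : X) : R).

(** The ambient segment keeps all measures finite, so that additivity survives [fine]. *)
Lemma measure_partition (I : choiceType) (r : seq I) (A : I -> set R)
    (B : set R) (a b : R) :
  uniq r -> B `<=` `[a, b]%classic ->
  (forall i, i \in r -> lebesgue_measurable (A i)) ->
  (forall i j s, i \in r -> j \in r -> A i s -> A j s -> i = j) ->
  (forall s, B s <-> exists2 i, i \in r & A i s) ->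
  lebesgue_measurable B /\ mu B = \sum_(i <- r) mu (A i).
Proof.
elim: r B => [|i r ih] B /=.
  move=> _ Bab _ _ BA; have -> : B = set0.
    by apply/seteqP; split => // s /BA[].
  by split; [exact: lebesgue_measurable0|rewrite big_nil measure0].
move=> /andP[ir ur] Bab mA tA BA.
pose B' := [set s | exists2 j, j \in r & A j s].
have BE : B = A i `|` B'.
  apply/seteqP; split => s.
    by move=> /BA[j]; rewrite inE => /orP[/eqP ->|jr]; [left|right; exists j].
  case=> [Ais|[j jr Ajs]]; apply/BA; first by exists i; rewrite ?mem_head.
  by exists j => //; rewrite inE jr orbT.
have [||||mB' B'E] := ih B' ur.
- by move=> s B's; apply: Bab; rewrite BE; right.
- by move=> j jr; apply: mA; rewrite inE jr orbT.
- by move=> j k s jr kr; apply: tA; rewrite inE ?jr ?kr orbT.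
- by move=> s.
have mAi : lebesgue_measurable (A i) by apply: mA; rewrite mem_head.
split; first by rewrite BE; exact: lebesgue_measurableU.
rewrite big_cons -B'E BE (@fine_completedU _ a b)//.
- by move=> s Ais; apply: Bab; rewrite BE; left.
- by move=> s Ais; apply: Bab; rewrite BE; right.
- apply/seteqP; split => // s [Ais [j jr Ajs]].
  have ij : i = j by apply: (tA i j s) => //; rewrite inE ?eqxx ?jr ?orbT.
  by move: ir; rewrite ij jr.
Qed.

Lemma convex_scale_sum (I : Type) (r : seq I) (c : I -> R) (z : X) :
  convex_elements X z -> (forall i, 0 <= c i) ->
  (\sum_(i <- r) c i) *:: z = \big[sadd/theta]_(i <- r) (c i *:: z).
Proof.
move=> zc c0; elim: r => [|i r ih]; first by rewrite !big_nil sscale0.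
by rewrite !big_cons zc ?ih// sumr_ge0.
Qed.

(** [simple_integral] sums over the distinct values of [f], whereas here several cells may carry the
    same value. Merging their weights is legitimate because [P] takes only convex values. *)
Lemma simple_integral_partition (I : choiceType) (r : seq I) (A : I -> set R)
    (y : I -> X) (D : set R) (f : R -> X) (a b : R) :
  uniq r -> D `<=` `[a, b]%classic ->
  (forall i, i \in r -> lebesgue_measurable (A i)) ->
  (forall i j s, i \in r -> j \in r -> A i s -> A j s -> i = j) ->
  (forall s, D s <-> exists2 i, i \in r & A i s) ->
  (forall i s, i \in r -> A i s -> f s = y i) ->
  simple_mapping D f /\
  simple_integral P D f = \big[sadd/theta]_(i <- r) (mu (A i) *:: P (y i)).
Proof.
move=> ur Dab mA tA DA fA.
have level x : lebesgue_measurable (D `&` f @^-1` [set x]) /\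
    mu (D `&` f @^-1` [set x]) *:: P x =
    \big[sadd/theta]_(i <- r | y i == x) (mu (A i) *:: P (y i)).
  have [|||||mL LE] := @measure_partition _ [seq i <- r | y i == x] A
      (D `&` f @^-1` [set x]) a b.
  - exact: filter_uniq.
  - by move=> s [/Dab].
  - by move=> i; rewrite mem_filter => /andP[_]; exact: mA.
  - by move=> i j s; rewrite !mem_filter => /andP[_ ir] /andP[_ jr]; exact: tA.
  - move=> s; split => [[/DA[i ir Ais] fx]|[i]].
      by exists i => //; rewrite mem_filter ir -(fA _ _ ir Ais) fx eqxx.
    rewrite mem_filter => /andP[/eqP yx ir] Ais; split; last first.
      by rewrite /= -yx; exact: fA.
    by apply/DA; exists i.
  split => //; rewrite LE convex_scale_sum ?big_filter; last 2 first.
  - exact: convexifying_convex.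
  - by move=> i; exact: fine_completed_ge0.
  by apply: eq_bigr => i /eqP ->.
have fin : finite_set (f @` D).
  apply: (@sub_finite_set _ _ (y @` [set` r])).
    by move=> _ [s /DA[i ir Ais] <-]; exists i => //; rewrite (fA _ _ ir Ais).
  by apply: finite_image; exact: finite_seq.
split; first by split => // x; have [] := level x.
rewrite /simple_integral fsbig_finite//.
rewrite (eq_bigr (fun x => \big[sadd/theta]_(i <- r)
    (if y i == x then mu (A i) *:: P (y i) else theta))); last first.
  by move=> x _; have [_ ->] := level x; rewrite big_mkcond.
rewrite exchange_big /=; rewrite !big_seq; apply: eq_bigr => i ir.
(* An empty cell may carry a label that [f] never takes; its weight is then zero. *)
have [yi|yi] := pselect ((f @` D) (y i)).
  have yV : y i \in fset_set (f @` D) by rewrite in_fset_set// in_setE.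
  rewrite (bigD1_seq (y i)) //=; last exact: fset_uniq.
  rewrite eqxx big1 ?sadd0// => x.
  by rewrite eq_sym => /negbTE ->.
rewrite (_ : A i = set0) ?measure0 ?sscale0; last first.
  apply/seteqP; split => // s Ais; apply: yi; exists s; last exact: fA Ais.
  by apply/DA; exists i.
by rewrite big1// => x _; case: ifP.
Qed.

Lemma simple_integral_cst (a b : R) (x : X) : a <= b ->
  simple_mapping `[a, b] (cst x) /\
  simple_integral P `[a, b]%classic (cst x) = (b - a) *:: P x.
Proof.
move=> ab; have [||||||sm ->] := @simple_integral_partition _ [:: tt]
  (fun=> `[a, b]%classic) (cst x) `[a, b]%classic (cst x) a b => //.
- by move=> _ _; exact: lebesgue_measurable_itv.
- by move=> [] [].
- by move=> s; split => [|[]]//; exists tt; rewrite ?mem_head.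
- by rewrite big_seq1 fine_completed_itv.
Qed.

(** A common refinement with cells indexed by pairs of values; pairs that never occur give empty
    cells of weight zero. *)
Lemma simple_integral_common (a b : R) (f g : R -> X) :
  simple_mapping `[a, b] f -> simple_mapping `[a, b] g ->
  exists (r : seq (X * X)) (A : X * X -> set R),
  [/\ \sum_(z <- r) mu (A z) = mu `[a, b],
      forall z s, A z s -> [/\ s \in `[a, b], f s = z.1 & g s = z.2],
      simple_integral P `[a, b] f = \big[sadd/theta]_(z <- r) (mu (A z) *:: P z.1) &
      simple_integral P `[a, b] g = \big[sadd/theta]_(z <- r) (mu (A z) *:: P z.2)].
Proof.
set D := `[a, b]%classic; move=> [finf mf] [fing mg].
pose r := fset_set (f @` D `*` g @` D).
pose A (z : X * X) := D `&` f @^-1` [set z.1] `&` (D `&` g @^-1` [set z.2]).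
have fin : finite_set (f @` D `*` g @` D) by exact: finite_setX.
have mA z : lebesgue_measurable (A z) by exact: lebesgue_measurableI.
have AE z s : A z s -> [/\ D s, f s = z.1 & g s = z.2] by case=> [[] ? ? []].
have DA s : D s -> exists2 z, z \in r & A z s.
  move=> Ds; exists (f s, g s) => //.
  by rewrite in_fset_set// in_setE; split; exists s.
have tA (i j : X * X) s : i \in (r : seq _) -> j \in (r : seq _) -> A i s -> A j s -> i = j.
  case: i j => [i1 i2] [j1 j2] _ _ /AE[_ /= <- <-] /AE[_ /= -> ->] //.
have DA' s : D s <-> exists2 z, z \in (r : seq _) & A z s.
  by split => [/DA[z]|[z _ /AE[]]]//; exists z.
exists r, A; have [|||||_ If] := @simple_integral_partition _ (r : seq _) A fst D f a b (fset_uniq _) => //.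
  by move=> i s _ /AE[].
have [|||||_ Ig] := @simple_integral_partition _ (r : seq _) A snd D g a b (fset_uniq _) => //.
  by move=> i s _ /AE[].
have [||||_ mu_D] := @measure_partition _ (r : seq _) A D a b (fset_uniq _) => //.
Qed.

Lemma dist_simple_integral (a b e : R) (f g : R -> X) : a <= b ->
  simple_mapping `[a, b] f -> simple_mapping `[a, b] g ->
  (forall s, s \in `[a, b] -> dist (f s) (g s) <= e) ->
  dist (simple_integral P `[a, b] f) (simple_integral P `[a, b] g) <=
    (b - a) * e.
Proof.
move=> ab sf sg fg.
have [r [A [mu_D AE -> ->]]] := simple_integral_common sf sg.
apply: (le_trans (dist_big_le _ _ _)).
apply: (@le_trans _ _ (\sum_(z <- r) mu (A z) * e)).
  apply: ler_sum => z _; rewrite dist_scale_ge0 ?fine_completed_ge0//.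
  have [[s As]|A0] := pselect (exists s, A z s).
    rewrite ler_wpM2l ?fine_completed_ge0//.
    apply: (le_trans (convexifying_nonexpansive cP _ _)).
    by have [Ds <- <-] := AE _ _ As; apply: fg.
  rewrite (_ : A z = set0) ?measure0 ?mul0r//.
  by apply/seteqP; split => // s As; apply: A0; exists s.
by rewrite -mulr_suml mu_D fine_completed_itv.
Qed.

End SimpleIntegral.

(** * The integral of uniformly continuous mappings *)

Section LIntegral.
Context (R : realType) (X : lspaceType R) (P : X -> X).
Hypothesis cP : convexifying P.

Local Notation mu A := (fine (completed_lebesgue_measure A%classic)).
Local Notation dist x y := (mdist (x : X) (y : X) : R).

(** The index set is the range over the large segment, so that integrals over different subsegments
    become sums over one index set and can be added term by term. *)
Lemma simple_integral_sub (a b c d : R) (f : R -> X) :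
  let V := fset_set (f @` `[a, b]%classic) in
  a <= c -> d <= b -> simple_mapping `[a, b] f ->
  simple_mapping `[c, d] f /\
  simple_integral P `[c, d] f =
    \big[sadd/theta]_(x <- V) (mu (`[c, d] `&` f @^-1` [set x]) *:: P x).
Proof.
move=> V ac db [finf mf].
have cdab s : s \in `[c, d] -> s \in `[a, b].
  by rewrite !in_itv /= => /andP[h1 h2]; rewrite (le_trans ac) ?(le_trans _ db).
apply: (@simple_integral_partition _ _ _ cP _ (V : seq _)
  (fun x => `[c, d] `&` f @^-1` [set x]) id _ _ c d (fset_uniq _)) => //.
- move=> x _.
  rewrite (_ : _ `&` _ = `[c, d] `&` (`[a, b] `&` f @^-1` [set x])).
    by apply: lebesgue_measurableI => //; exact: lebesgue_measurable_itv.
  by rewrite setIA (setIidl (B := `[a, b]%classic))// => s; exact: cdab.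
- by move=> x y s _ _ [_ <-] [_ <-].
- move=> s; split=> [sD|[x _ []]//]; exists (f s) => //.
  by rewrite in_fset_set// in_setE; exists s => //=; exact: cdab.
- by move=> x s _ [].
Qed.

Lemma simple_integralD (a b c : R) (f : R -> X) : a <= c -> c <= b ->
  simple_mapping `[a, b] f ->
  [/\ simple_mapping `[a, c] f, simple_mapping `[c, b] f &
  simple_integral P `[a, b] f =
    simple_integral P `[a, c] f +:: simple_integral P `[c, b] f].
Proof.
move=> ac cb sf.
have [_ ->] := simple_integral_sub (lexx a) (lexx b) sf.
have [sac ->] := simple_integral_sub (lexx a) cb sf.
have [scb ->] := simple_integral_sub ac (lexx b) sf.
split => //; rewrite -big_split /=; apply: eq_bigr => x _.
have zc : convex_elements X (P x) by exact: convexifying_convex.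
rewrite -zc ?fine_completed_ge0//; congr (_ *:: _).
have mL : lebesgue_measurable (`[a, b] `&` f @^-1` [set x]) by case: sf.
have sub (D : set R) : D `<=` `[a, b] -> D `&` f @^-1` [set x] =
    D `&` (`[a, b] `&` f @^-1` [set x]).
  by move=> Dab; rewrite setIA (setIidl Dab).
rewrite (sub `[a, c]%classic) ?(sub `[c, b]%classic).
- by rewrite -(fine_completed_split ac cb mL) setIA setIid.
- by move=> s; rewrite /= !in_itv /= => /andP[h1 ->]; rewrite (le_trans ac).
- by move=> s; rewrite /= !in_itv /= => /andP[-> h1]; rewrite (le_trans _ cb).
Qed.

Definition uniformly_continuous_on (a b : R) (f : R -> X) :=
  forall e, 0 < e -> exists2 d, 0 < d & forall s s', s \in `[a, b] ->
    s' \in `[a, b] -> `|s - s'| < d -> dist (f s) (f s') <= e.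

Lemma uniformly_continuous_sub (a b c d : R) (f : R -> X) : a <= c -> d <= b ->
  uniformly_continuous_on a b f -> uniformly_continuous_on c d f.
Proof.
move=> ac db uf e /uf[d0 d00 H]; exists d0 => // s s'.
rewrite !in_itv /= => /andP[h1 h2] /andP[h3 h4].
by apply: H; rewrite in_itv /= ?(le_trans ac)// ?(le_trans _ db).
Qed.

Lemma simple_mapping_step (a b : R) (f : R -> X) (n : nat) : a <= b ->
  let g s := f (a + (Num.truncn ((s - a) * n.+1%:R))%:R / n.+1%:R) in
  simple_mapping `[a, b] g.
Proof.
move=> ab g; set N : R := n.+1%:R.
have N0 : 0 < N by rewrite ltr0n.
pose A i := `[a, b] `&` `[a + i%:R / N, a + i.+1%:R / N[ : set R.
have AE i s : a <= s -> A i s -> Num.truncn ((s - a) * N) = i.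
  move=> sa [_]; rewrite /= in_itv /= => /andP[h1 h2]; apply: truncn_def.
  by rewrite -ler_pdivrMr// -ltr_pdivlMr// lerBrDl ltrBlDl h1 h2.
have [n1 n1E] : exists n1, n1 = (Num.truncn ((b - a) * N)).+1 by eexists.
have [|||||sg _] := @simple_integral_partition _ _ _ cP _
  (iota 0 n1) A (fun i => f (a + i%:R / N))
  `[a, b]%classic g a b (iota_uniq _ _).
- by [].
- by move=> i _; apply: lebesgue_measurableI; exact: lebesgue_measurable_itv.
- move=> i j s _ _ Ai Aj; have sa : a <= s.
    by case: Ai; rewrite /= in_itv /= => /andP[].
  by rewrite -(AE _ _ sa Ai) (AE _ _ sa Aj).
- move=> s; split; last by case=> i _ [].
  rewrite /= in_itv /= => /andP[sa sb]; exists (Num.truncn ((s - a) * N)).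
    rewrite mem_iota /= add0n n1E ltnS le_truncn// ler_wpM2r ?(ltW N0)//.
    by rewrite lerD2r.
  split; first by rewrite /= in_itv /= sa sb.
  have /truncn_itv/andP[h1 h2] : 0 <= (s - a) * N.
    by rewrite mulr_ge0 ?subr_ge0// ltW.
  by rewrite /= in_itv /= -lerBrDl -ltrBlDl ler_pdivrMr// ltr_pdivlMr// h1 h2.
- move=> i s _ Ai; rewrite /g (AE i s)//.
  by case: Ai; rewrite /= in_itv /= => /andP[].
- exact: sg.
Qed.

Lemma simple_mapping_approx (a b : R) (f : R -> X) : a <= b ->
  uniformly_continuous_on a b f ->
  exists g : nat -> R -> X, (forall k, simple_mapping `[a, b] (g k)) /\
    forall e, 0 < e -> \forall k \near \oo,
      forall s, s \in `[a, b] -> dist (f s) (g k s) <= e.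
Proof.
move=> ab uf.
exists (fun n s => f (a + (Num.truncn ((s - a) * n.+1%:R))%:R / n.+1%:R)).
split=> [k|e e0]; first exact: simple_mapping_step.
have [d d0 H] := uf _ e0.
have := near_infty_natSinv_lt (PosNum d0); apply: filterS => n /= nd s.
rewrite in_itv /= => /andP[sa sb].
have N0 : 0 < n.+1%:R :> R by rewrite ltr0n.
have /truncn_itv/andP[] : 0 <= (s - a) * n.+1%:R.
  by rewrite mulr_ge0 ?subr_ge0// ltW.
set m : R := (Num.truncn _)%:R => h1.
rewrite -[X in _ < X]natr1 -/m => h2.
have {}h1 : m / n.+1%:R <= s - a by rewrite ler_pdivrMr.
have {}h2 : s - a < m / n.+1%:R + n.+1%:R^-1.
  by rewrite -{2}(mul1r n.+1%:R^-1) -mulrDl ltr_pdivlMr.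
have m0 : 0 <= m / n.+1%:R by rewrite divr_ge0 ?ler0n.
have {}nd : n.+1%:R^-1 < d := nd.
move: h1 h2 m0 nd; set q := m / _; set i := _^-1 => h1 h2 m0 nd.
apply: H; rewrite ?in_itv /= ?sa ?sb//; first by apply/andP; split; lra.
by rewrite ger0_norm; lra.
Qed.

(** Stated for any limit [v], because [lintegral] is a choice among such limits; the estimate does
    not depend on the approximating sequence. *)
Lemma lintegral_simple_dist (a b e : R) (f g : R -> X) (v : X) : a <= b ->
  is_lintegral P `[a, b]%classic f v -> simple_mapping `[a, b] g ->
  (forall s, s \in `[a, b] -> dist (f s) (g s) <= e) ->
  dist v (simple_integral P `[a, b] g) <= (b - a) * e.
Proof.
move=> ab [h [sh hf hv]] sg fg.
apply/ler_addgt0Pr => r r0.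
have d0 : 0 < r / (2 * (b - a + 1)).
  by rewrite divr_gt0// mulr_gt0//; lra.
set d := r / _ in d0.
have [k [hk vk]] : exists k, (forall s, s \in `[a, b] -> dist (f s) (h k s) < d) /\
    dist v (simple_integral P `[a, b] (h k)) < r / 2.
  have H1 : \forall k \near \oo, dist v (simple_integral P `[a, b] (h k)) < r / 2.
    by apply: metricType_numDomainType.cvgr_dist_lt => //; rewrite divr_gt0.
  have H2 : \forall k \near \oo, forall s, s \in `[a, b] -> dist (f s) (h k s) < d.
    apply: (hf (fun h => forall s, s \in `[a, b] -> dist (f s) (h s) < d)).
    apply/uniform_nbhs; exists [set xy | ball xy.1 d xy.2]; split.
      exact: (entourage_ball _ (PosNum d0)).
    by move=> h' /= H s /H; rewrite ballEmdist.
  near \oo => k; exists k; split.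
    by near: k.
  by near: k.
apply: (le_trans (metric_triangle _ (simple_integral P `[a, b] (h k)) _)).
have : dist (simple_integral P `[a, b] (h k)) (simple_integral P `[a, b] g)
    <= (b - a) * (d + e).
  apply: (dist_simple_integral cP) => // s sab.
  apply: (le_trans (metric_triangle _ (f s) _)).
  by rewrite lerD ?fg// metric_sym ltW// hk.
have : (b - a) * d <= r / 2.
  have -> : r / 2 = (b - a + 1) * d.
    by rewrite /d; field; rewrite gt_eqF//; lra.
  by rewrite ler_wpM2r ?(ltW d0)//; lra.
by rewrite mulrDr; lra.
Unshelve. all: by end_near. Qed.

(** The uniform distance of simple approximants controls the distance of their integrals, which
    therefore form a Cauchy sequence in the complete space X. *)
Lemma is_lintegral_lintegral (a b : R) (f : R -> X) : a <= b ->
  uniformly_continuous_on a b f ->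
  is_lintegral P `[a, b]%classic f (lintegral P a b f).
Proof.
move=> ab uf; rewrite /lintegral; apply: xgetPex.
have [g [sg gf]] := simple_mapping_approx ab uf.
have : cvg (simple_integral P `[a, b]%classic (g k) @[k --> \oo]).
  apply: cauchy_cvg; apply: cauchy_exP => e e0.
  have d0 : 0 < e / (4 * (b - a + 1)) by rewrite divr_gt0// mulr_gt0//; lra.
  set d := e / _ in d0.
  have [N _ HN] := gf _ d0.
  exists (simple_integral P `[a, b]%classic (g N)); exists N => // k Nk.
  rewrite /= ballEmdist /=.
  apply: (@le_lt_trans _ _ ((b - a) * (d + d))).
    apply: (dist_simple_integral cP) => // s sab.
    apply: (le_trans (metric_triangle _ (f s) _)).
    by rewrite lerD ?(HN k)// metric_sym (HN N) /=.
  have -> : (b - a) * (d + d) = e / 2 * ((b - a) / (b - a + 1)).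
    by rewrite /d; field; rewrite gt_eqF//; lra.
  have : (b - a) / (b - a + 1) <= 1 by rewrite ler_pdivrMr; lra.
  have : 0 <= (b - a) / (b - a + 1) by rewrite divr_ge0; lra.
  by nra.
move=> /cvg_ex[v gv]; exists v; exists g; split => //.
move=> U /uniform_nbhs[E [entE EU]].
move: entE; rewrite -entourage_ballE => -[e /= e0 eE].
have e20 : 0 < e / 2 by rewrite divr_gt0.
have := gf _ e20; apply: filterS => k H; apply: EU => s sab; apply: eE.
by rewrite /= ballEmdist /= (le_lt_trans (H _ sab))//; lra.
Qed.

Lemma lintegral_cst_dist (a b e : R) (f : R -> X) (x : X) : a <= b ->
  uniformly_continuous_on a b f ->
  (forall s, s \in `[a, b] -> dist (f s) x <= e) ->
  dist (lintegral P a b f) ((b - a) *:: P x) <= (b - a) * e.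
Proof.
move=> ab uf fx; have [sx <-] := simple_integral_cst cP x ab.
by apply: (lintegral_simple_dist (f := f)) => //; exact: is_lintegral_lintegral.
Qed.

Lemma lintegralD (a b c : R) (f : R -> X) : a <= c -> c <= b ->
  uniformly_continuous_on a b f ->
  lintegral P a b f = lintegral P a c f +:: lintegral P c b f.
Proof.
move=> ac cb uf; have ab := le_trans ac cb.
apply: mdist_positivity; apply/eqP; rewrite eq_le mdist_ge0 andbT.
apply/ler_addgt0Pr => r r0; rewrite add0r.
have d0 : 0 < r / (2 * (b - a + 1)).
  by rewrite divr_gt0// mulr_gt0//; lra.
set d := r / _ in d0.
have [g [sg gf]] := simple_mapping_approx ab uf.
have [N _ /(_ N (leqnn N)) HN] := gf _ d0; move: {sg} (sg N) HN.
move: (g N) => {g gf N} g sg fg.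
have [sac scb E] := simple_integralD ac cb sg.
apply: (le_trans (metric_triangle _ (simple_integral P `[a, b] g) _)).
have h1 : dist (lintegral P a b f) (simple_integral P `[a, b] g) <= (b - a) * d.
  by apply: (lintegral_simple_dist (f := f)) => //; exact: is_lintegral_lintegral.
have h2 : dist (simple_integral P `[a, c] g) (lintegral P a c f) <= (c - a) * d.
  rewrite metric_sym; apply: (lintegral_simple_dist (f := f)) => //.
    by apply: is_lintegral_lintegral => //; exact: uniformly_continuous_sub uf.
  move=> s; rewrite in_itv /= => /andP[h h']; apply: fg.
  by rewrite in_itv /= h (le_trans h').
have h3 : dist (simple_integral P `[c, b] g) (lintegral P c b f) <= (b - c) * d.
  rewrite metric_sym; apply: (lintegral_simple_dist (f := f)) => //.
    by apply: is_lintegral_lintegral => //; exact: uniformly_continuous_sub uf.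
  move=> s; rewrite in_itv /= => /andP[h h']; apply: fg.
  by rewrite in_itv /= h' (le_trans ac).
have : dist (simple_integral P `[a, b] g) (lintegral P a c f +:: lintegral P c b f)
    <= (c - a) * d + (b - c) * d.
  by rewrite E (le_trans (dist_add_le _ _ _ _))// lerD.
have -> : r = 2 * ((b - a + 1) * d).
  by rewrite /d; field; rewrite gt_eqF//; lra.
by lra.
Qed.

End LIntegral.

(* Replaces change of variables and comparison under the integral sign: [D] is
   a distance between two integrals with moving endpoints, [F] the claimed
   bound, and only their small increments have to be compared. *)
Lemma increment_le (R : realType) (A : R) (D F : R -> R) : 0 <= A ->
  (forall e, 0 < e -> exists2 d, 0 < d & forall v h, 0 <= v -> 0 <= h ->
    h <= d -> v + h <= A -> D (v + h) - D v <= F (v + h) - F v + e * h) ->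
  D A - D 0 <= F A - F 0.
Proof.
move=> A0 H; apply/ler_addgt0Pr => r r0.
have e0 : 0 < r / (A + 1) by rewrite divr_gt0//; lra.
have [d d0 {}H] := H _ e0; set e := r / _ in e0 H.
(* The successor makes [n] positive and [A / n] at most [d]. The errors [e * h] of the [n] steps add
   up to [e * A], which is below [r]. *)
pose n := (Num.truncn (A / d)).+1; pose h := A / n%:R.
have n0 : 0 < n%:R :> R by rewrite ltr0n.
have h0 : 0 <= h by rewrite divr_ge0// ltW.
have hd : h <= d.
  by rewrite ler_pdivrMr// mulrC -ler_pdivrMr// ltW// truncnS_gt.
have nh : n%:R * h = A by rewrite /h mulrC divfK// gt_eqF.
have step i : (i <= n)%N ->
    D (i%:R * h) - D 0 <= F (i%:R * h) - F 0 + e * (i%:R * h).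
  elim: i => [_|i ih i_n]; first by rewrite mul0r !subrr mulr0 addr0.
  have iE : i.+1%:R * h = i%:R * h + h by rewrite -natr1 mulrDl mul1r.
  have {}ih := ih (ltnW i_n).
  have /(_ h0 hd) := H (i%:R * h) h (mulr_ge0 (ler0n _ _) h0).
  rewrite -iE -nh ler_wpM2r// ?ler_nat// => /(_ isT).
  have -> : e * (i.+1%:R * h) = e * (i%:R * h) + e * h by rewrite iE mulrDr.
  by lra.
have := step n (leqnn n); rewrite nh => /le_trans; apply.
have -> : r = e * A + e by rewrite /e; field; rewrite gt_eqF//; lra.
by lra.
Qed.

(** * Comparison of means *)

Section Primitive.
Context (R : realType) (X : lspaceType R).
Implicit Types (f : R -> X) (J : R -> R -> X).

Local Notation dist x y := (mdist (x : X) (y : X) : R).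

(* [J x y] stands for the integral of [f] from [x] to [y]; of the integral only
   additivity and this uniform first-order approximation are used. *)
Definition is_primitive (a b : R) f J :=
  (forall x y z, a <= x -> x <= y -> y <= z -> z <= b ->
     J x z = J x y +:: J y z) /\
  (forall e, 0 < e -> exists2 d, 0 < d & forall x u y,
     a <= x -> x <= u -> u <= y -> y <= b -> y - x <= d ->
     dist (J x y) ((y - x) *:: f u) <= e * (y - x)).

Lemma is_primitive_refl a b f J x : a <= x -> x <= b ->
  is_primitive a b f J -> J x x = theta.
Proof.
move=> ax xb [_ /(_ 1 ltr01)[d d0 H]].
apply: mdist_positivity; apply/eqP; rewrite eq_le mdist_ge0 andbT.
by have := H x x x ax (lexx x) (lexx x) xb; rewrite subrr sscale0 mulr0 ltW// => ->.
Qed.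

(** Reflection lets the argument for a piece to the left serve for a piece to the right;
    commutativity of addition restores the order of the summands. *)
Lemma is_primitive_opp a b f J : is_primitive a b f J ->
  is_primitive (- b) (- a) (f \o -%R) (fun x y => J (- y) (- x)).
Proof.
move=> [Jadd Jloc]; split.
  move=> x y z bx xy yz za; rewrite saddC; apply: Jadd; rewrite ?lerN2//.
    by rewrite lerNr.
  by rewrite lerNl.
move=> e /Jloc[d d0 H]; exists d => // x u y bx xu uy ya yxd.
have E : y - x = - x - (- y) by rewrite opprK addrC.
rewrite E; apply: H; rewrite ?lerN2//; first by rewrite lerNr.
  by rewrite lerNl.
by rewrite -E.
Qed.

Section Transport.
Variables (w I : R -> R) (W : R).

Hypothesis I0 : I 0 = 0.
Hypothesis I_incr : forall x y, 0 <= x -> x <= y -> (y - x) * w x <= I y - I x.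
Hypothesis W_ge0 : 0 <= W.

(* The mean over the long interval splits off the piece [p - A, p]; its point
   [p - v] is moved to [p + v * (G / S)], at distance [v * (G + S) / S]. *)
Lemma primitive_transport (a b p A G S : R) f J :
  0 <= A -> 0 < G -> 0 < S -> a <= p - A -> p + A * (G / S) <= b ->
  is_primitive a b f J ->
  (forall s, a <= s -> s <= b -> convex_elements X (f s)) ->
  (forall s s', a <= s -> s <= s' -> s' <= b ->
     dist (f s) (f s') <= W * w (s' - s)) ->
  let J1 := J p (p + A * (G / S)) in
  dist (G^-1 *:: J1) ((G + S)^-1 *:: (J1 +:: J (p - A) p)) <=
    S / (G + S) ^+ 2 * I ((G + S) * A / S) * W.
Proof.
move=> A0 G0 S0 ap pb Jp fc fw; cbv zeta; set H := G + S.
have H0 : 0 < H by rewrite addr_gt0.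
set k := G / S in pb *.
have k0 : 0 < k by rewrite divr_gt0.
(* Only the part of length [v] next to [p] is moved; [v] grows from 0 to [A]. *)
pose D v := dist (G^-1 *:: J p (p + v * k))
  (H^-1 *:: (J p (p + v * k) +:: J (p - v) p)).
pose F v := S / H ^+ 2 * I (H * v / S) * W.
suff : D A - D 0 <= F A - F 0.
  rewrite {2}/D {2}/F mul0r addr0 subr0 mulr0 mul0r I0 mulr0 mul0r subr0.
  have Ak0 : 0 <= A * k by rewrite mulr_ge0// ltW.
  by rewrite (is_primitive_refl _ _ Jp) ?sadd0 ?sscale_theta ?mdistxx ?subr0//; lra.
apply: increment_le => // e e0.
have [Jadd Jloc] := Jp.
(* This tolerance makes each of the two approximation errors [l1] and [l3] at most [e * h / 2]. *)
have eS0 : 0 < e * S / 2 by rewrite divr_gt0// mulr_gt0.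
have [d d0 {}Jloc] := Jloc _ eS0; set e' := e * S / 2 in eS0 Jloc.
exists (Num.min d (d / k)); first by rewrite lt_min d0 divr_gt0.
move=> v h v0 h0; rewrite le_min => /andP[hd hdk] vhA.
have hkd : h * k <= d by rewrite -ler_pdivlMr.
have vk0 : 0 <= v * k by rewrite mulr_ge0// ltW.
have hk0 : 0 <= h * k by rewrite mulr_ge0// ltW.
have vhk : (v + h) * k <= A * k by rewrite ler_wpM2r// ltW.
rewrite mulrDl in vhk.
set J1 := J p (p + v * k); set J2 := J (p - v) p.
pose J' := J (p + v * k) (p + v * k + h * k); pose J'' := J (p - v - h) (p - v).
have E1 : J p (p + (v + h) * k) = J1 +:: J'.
  by rewrite mulrDl addrA; apply: Jadd; lra.
have E2 : J (p - (v + h)) p = J'' +:: J2.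
  by rewrite opprD addrA; apply: Jadd; lra.
pose y' := f (p + v * k); pose y'' := f (p - v).
have d1 : dist J' ((h * k) *:: y') <= e' * (h * k).
  have := Jloc (p + v * k) (p + v * k) (p + v * k + h * k).
  by rewrite (_ : p + v * k + h * k - _ = h * k); [apply; lra|ring].
have d2 : dist J'' (h *:: y'') <= e' * h.
  have := Jloc (p - v - h) (p - v) (p - v).
  by rewrite (_ : p - v - (p - v - h) = h); [apply; lra|ring].
have d3 : dist y'' y' <= W * w (H * v / S).
  have -> : H * v / S = p + v * k - (p - v).
    by rewrite /k /H; field; rewrite gt_eqF.
  by apply: fw; lra.
(* The value of [w] at the left endpoint bounds the increment of [I] from below, at the travel
   distance [H * v / S]. *)
have dF : h / H * (W * w (H * v / S)) <= F (v + h) - F v.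
  have -> : F (v + h) - F v =
      S / H ^+ 2 * W * (I (H * (v + h) / S) - I (H * v / S)) by rewrite /F; ring.
  have -> : h / H * (W * w (H * v / S)) =
      S / H ^+ 2 * W * ((H * (v + h) / S - H * v / S) * w (H * v / S)).
    by field; rewrite !gt_eqF.
  apply: ler_wpM2l; first by rewrite mulr_ge0// divr_ge0// ?exprn_ge0// ltW.
  apply: I_incr; first by rewrite !mulr_ge0// ?invr_ge0 ltW.
  by rewrite ler_wpM2r ?invr_ge0 ?(ltW S0)// ler_wpM2l ?(ltW H0)// lerDl.
have dJ : dist (G^-1 *:: J') (H^-1 *:: (J' +:: J'')) <=
    h / H * (W * w (H * v / S)) + e * h.
  have yc : convex_elements X y' by apply: fc; lra.
  have G1 : 0 <= G^-1 by rewrite invr_ge0 ltW.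
  have H1 : 0 <= H^-1 by rewrite invr_ge0 ltW.
  apply: (le_trans (metric_triangle _ (G^-1 *:: ((h * k) *:: y')) _)).
  have l1 : dist (G^-1 *:: J') (G^-1 *:: ((h * k) *:: y')) <= e * h / 2.
    rewrite dist_scale_ge0//.
    have -> : e * h / 2 = G^-1 * (e' * (h * k)).
      by rewrite /e' /k; field; rewrite !gt_eqF.
    exact: ler_wpM2l.
  (* The mass balance: both sides weigh [y'] by [h / S]. *)
  have E : G^-1 *:: ((h * k) *:: y') = H^-1 *:: ((h * k) *:: y' +:: h *:: y').
    have hhk0 : 0 <= h * k + h by rewrite addr_ge0.
    rewrite -yc// !sscaleA; congr (_ *:: _).
    by rewrite /k /H; field; rewrite !gt_eqF ?addr_gt0.
  have l2 : dist (G^-1 *:: ((h * k) *:: y'))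
      (H^-1 *:: ((h * k) *:: y' +:: h *:: y'')) <= h / H * (W * w (H * v / S)).
    have -> : h / H * (W * w (H * v / S)) = H^-1 * (h * (W * w (H * v / S))).
      by ring.
    rewrite E dist_scale_ge0//; apply: ler_wpM2l => //.
    apply: (le_trans (dist_add_le _ _ _ _)); rewrite mdistxx add0r.
    by rewrite dist_scale_ge0//; apply: ler_wpM2l => //; rewrite metric_sym.
  have l3 : dist (H^-1 *:: ((h * k) *:: y' +:: h *:: y''))
      (H^-1 *:: (J' +:: J'')) <= e * h / 2.
    rewrite dist_scale_ge0//.
    have -> : e * h / 2 = H^-1 * (e' * (h * k) + e' * h).
      by rewrite /e' /k /H; field; rewrite !gt_eqF ?addr_gt0.
    apply: ler_wpM2l => //; apply: (le_trans (dist_add_le _ _ _ _)).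
    by rewrite lerD// metric_sym.
  have := metric_triangle (G^-1 *:: ((h * k) *:: y'))
    (H^-1 *:: ((h * k) *:: y' +:: h *:: y'')) (H^-1 *:: (J' +:: J'')).
  by lra.
suff : D (v + h) <= D v + dist (G^-1 *:: J') (H^-1 *:: (J' +:: J'')) by lra.
rewrite /D E1 E2 (saddC J'') saddACA !sscaleDr.
exact: dist_add_le.
Qed.

(** Since [f t] is convex, its multiple is additive in the length; each new piece [h *:: f t] is
    compared with [h *:: f (t + v)] at cost [h * (W * w v)]. *)
Lemma primitive_value_dist (a b t A : R) f J :
  0 <= A -> a <= t -> t + A <= b -> is_primitive a b f J ->
  convex_elements X (f t) ->
  (forall s s', a <= s -> s <= s' -> s' <= b ->
     dist (f s) (f s') <= W * w (s' - s)) ->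
  dist (A *:: f t) (J t (t + A)) <= I A * W.
Proof.
move=> A0 at_ tb Jp fc fw.
pose D v := dist (v *:: f t) (J t (t + v)); pose F v := I v * W.
suff : D A - D 0 <= F A - F 0.
  rewrite {2}/D {2}/F I0 mul0r addr0 sscale0.
  by rewrite (is_primitive_refl _ _ Jp) ?mdistxx ?subr0//; lra.
apply: increment_le => // e e0.
have [Jadd Jloc] := Jp.
have [d d0 {}Jloc] := Jloc _ e0; exists d => // v h v0 h0 hd vhA.
have E : J t (t + (v + h)) = J t (t + v) +:: J (t + v) (t + v + h).
  by rewrite addrA; apply: Jadd; lra.
have d1 : dist (J (t + v) (t + v + h)) (h *:: f (t + v)) <= e * h.
  have := Jloc (t + v) (t + v) (t + v + h).
  by rewrite (_ : t + v + h - _ = h); [apply; lra|ring].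
have d2 : dist (h *:: f t) (h *:: f (t + v)) <= h * (W * w v).
  rewrite dist_scale_ge0//; apply: ler_wpM2l => //.
  by have := fw t (t + v); rewrite (_ : t + v - t = v); [apply; lra|ring].
have d3 : h * (W * w v) <= F (v + h) - F v.
  rewrite /F -mulrBl mulrCA mulrC ler_wpM2r//.
  by have := I_incr v0 (y := v + h); rewrite lerDl (_ : v + h - v = h); [apply|ring].
have := dist_add_le (v *:: f t) (h *:: f t) (J t (t + v)) (J (t + v) (t + v + h)).
rewrite -fc// -E -!/(D _).
have := metric_triangle (h *:: f t) (h *:: f (t + v)) (J (t + v) (t + v + h)).
rewrite (metric_sym (h *:: f (t + v))).
rewrite -/(D v) -/(D (v + h)).
by lra.
Qed.

End Transport.

End Primitive.

(** * Moduli of continuity, real primitives and real lines in X *)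

Section Modulus.
Context (R : realType) (w : R -> R).
Hypothesis mw : modulus_of_continuity w.

Local Notation I := (Iomega w).

Lemma modulus_small e : 0 < e ->
  exists2 d, 0 < d & forall h, 0 <= h -> h <= d -> w h <= e.
Proof.
move=> e0; have /continuous_within_itvcyP[_] := modulus_continuous mw.
move=> /cvgrPdist_lt /(_ e e0); rewrite modulus0//.
rewrite near_withinE => -[d /= d0 H].
exists (d / 2); first by rewrite divr_gt0.
move=> h; rewrite le_eqVlt => /predU1P[<- _|h0 hd].
  by rewrite (modulus0 mw) ltW.
have /H : ball_ Num.norm 0 d h by rewrite /= sub0r normrN gtr0_norm//; lra.
move=> /(_ h0); rewrite sub0r normrN ger0_norm ?(modulus_ge0 mw) ?(ltW h0)//.
exact: ltW.
Qed.

(** A zero of [w] at [s] would propagate to all multiples of [s] by semi-additivity and to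
    everything below them by monotonicity. *)
Lemma modulus_gt0 s : (exists2 s, 0 <= s & w s != 0) -> 0 < s -> 0 < w s.
Proof.
move=> [s0 s00 ws0] s_gt0; rewrite lt_neqAle (modulus_ge0 mw) ?(ltW s_gt0)// andbT.
apply/eqP => ws; move/eqP: ws0; apply.
have wn n : w (n%:R * s) <= 0.
  elim: n => [|n ih]; first by rewrite mul0r (modulus0 mw).
  rewrite -natr1 mulrDl mul1r (le_trans (modulus_semiadditive mw _ _))//.
  - by rewrite mulr_ge0// ltW.
  - exact: ltW.
  - by rewrite -ws addr0.
apply/eqP; rewrite eq_le (modulus_ge0 mw)// andbT.
apply: le_trans (wn (Num.truncn (s0 / s)).+1); apply: (modulus_homo mw) => //.
by rewrite -ler_pdivrMr// ltW// truncnS_gt.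
Qed.

Lemma modulus_increment x y : 0 <= x -> x <= y -> w y <= w x + w (y - x).
Proof.
move=> x0 xy; rewrite -{1}(subrK x y) addrC.
by apply: (modulus_semiadditive mw) => //; rewrite subr_ge0.
Qed.

Lemma Iomega0 : I 0 = 0.
Proof. by rewrite /Iomega set_itv1 Rintegral_set1. Qed.

(** Together with [Iomega0], these bounds are all that is used of the integral of [w]. *)
Lemma Iomega_bounds (x y : R) : 0 <= x -> x <= y ->
  (y - x) * w x <= I y - I x <= (y - x) * w y.
Proof.
move=> x0 xy.
have wint : lebesgue_measure.-integrable `[0, y] (EFin \o w).
  apply: continuous_compact_integrable; first exact: segment_compact.
  apply: (continuous_subspaceW _ (modulus_continuous mw)).
  by move=> s; rewrite /= !in_itv /= => /andP[->].
have mI : measurable (`]x, y]%classic : set (measurableTypeR R)) by [].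
have wint' : lebesgue_measure.-integrable `]x, y] (EFin \o w).
  apply: integrableS wint => // s; rewrite /= !in_itv /= => /andP[xs ->].
  by rewrite (le_trans x0) ?(ltW xs).
have cint (c : R) : lebesgue_measure.-integrable `]x, y] (EFin \o (cst c : R -> R)).
  have ci : lebesgue_measure.-integrable `[x, y] (EFin \o (cst c : R -> R)).
    apply: continuous_compact_integrable; first exact: segment_compact.
    by apply: continuous_subspaceT => s; exact: cst_continuous.
  by apply: integrableS ci => //; exact: subset_itv_oc_cc.
have cE (c : R) : (\int[lebesgue_measure]_(_ in `]x, y]) c)%R = (y - x) * c.
  rewrite Rintegral_cst// mulrC; congr (_ * _).
  have := @lebesgue_measure_itv R `]x, y] => /= ->; rewrite lte_fin.
  by case: ltP => //= yx; rewrite (@le_anti _ _ x y) ?xy// subrr.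
rewrite /Iomega Rintegral_itvB//= -!cE; apply/andP; split.
- apply: le_Rintegral => //; first exact: (cint (w x)).
  move=> s /=; rewrite in_itv /= => /andP[xs _].
  by apply: (modulus_homo mw); rewrite // ltW.
- apply: le_Rintegral => //; first exact: (cint (w y)).
  move=> s /=; rewrite in_itv /= => /andP[xs sy].
  by apply: (modulus_homo mw); rewrite // (le_trans x0) ?(ltW xs).
Qed.

Lemma concave_modulusP l x y : concave_modulus w -> 0 <= l <= 1 ->
  0 <= x -> 0 <= y -> l * w x + (1 - l) * w y <= w (l * x + (1 - l) * y).
Proof.
move=> cw /andP[l0 l1] x0 y0.
have nonneg z : 0 <= z ->
    z \in (`[0, +oo[%classic : set (convex_lmodType R^o)).
  by move=> z0; apply: mem_set; rewrite /= in_itv /= z0.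
have := cw (Itv01 l0 l1) x y (nonneg x x0) (nonneg y y0).
by rewrite !convRE /= /unstable.onem; lra.
Qed.

End Modulus.

(** * Explicit antiderivatives of real functions *)

Section RealPrimitive.
Context (R : realType).
Implicit Types (r F : R -> R).

(** Differentiability with derivative [r], uniform along the whole line, the value of [r] being
    taken anywhere in the short segment. This is the scalar counterpart of the local half of
    [is_primitive], and it is stable under the affine substitutions used below. *)
Definition real_primitive r F := forall e, 0 < e -> exists2 d, 0 < d &
  forall x u y, x <= u -> u <= y -> y - x <= d ->
    `|F y - F x - (y - x) * r u| <= e * (y - x).

Lemma real_primitiveD r F r' F' : real_primitive r F -> real_primitive r' F' ->
  real_primitive (fun s => r s + r' s) (fun s => F s + F' s).
Proof.
move=> pF pF' e e0; have e20 : 0 < e / 2 by rewrite divr_gt0.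
have [d d0 H] := pF _ e20; have [d' d'0 H'] := pF' _ e20.
exists (Num.min d d'); first by rewrite lt_min d0.
move=> x u y xu uy; rewrite le_min => /andP[/(H x u y xu uy) h /(H' x u y xu uy) h'].
rewrite (_ : _ - _ = (F y - F x - (y - x) * r u) + (F' y - F' x - (y - x) * r' u)).
  by rewrite (le_trans (ler_normD _ _))//; lra.
by ring.
Qed.

Lemma real_primitiveZ c r F : real_primitive r F ->
  real_primitive (fun s => c * r s) (fun s => c * F s).
Proof.
move=> pF e e0; have e'0 : 0 < e / (`|c| + 1) by rewrite divr_gt0// ltr_wpDl.
have [d d0 H] := pF _ e'0; exists d => // x u y xu uy yxd.
rewrite (_ : _ - _ = c * (F y - F x - (y - x) * r u)); last by ring.
rewrite normrM; apply: (le_trans (ler_wpM2l _ (H x u y xu uy yxd))) => //.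
rewrite mulrA ler_wpM2r//; first by lra.
have c0 : 0 <= `|c| by [].
by rewrite mulrCA -{2}(mulr1 e) ler_wpM2l ?(ltW e0)// ler_pdivrMr; lra.
Qed.

Lemma real_primitive_cst c : real_primitive (cst c) (fun s => c * s).
Proof.
move=> e e0; exists 1 => // x u y xu uy _ /=.
rewrite (_ : _ - _ = 0); last by ring.
by rewrite normr0 mulr_ge0 ?(ltW e0)//; lra.
Qed.

Lemma real_primitive_shift c r F : real_primitive r F ->
  real_primitive (fun s => r (s + c)) (fun s => F (s + c)).
Proof.
move=> pF e /pF[d d0 H]; exists d => // x u y xu uy.
have -> : y - x = y + c - (x + c) by ring.
by apply: H; rewrite lerD2r.
Qed.

Lemma real_primitive_opp r F : real_primitive r F ->
  real_primitive (fun s => r (- s)) (fun s => - F (- s)).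
Proof.
move=> pF e /pF[d d0 H]; exists d => // x u y xu uy.
have -> : - F (- y) - - F (- x) = F (- x) - F (- y) by ring.
have -> : y - x = - x - - y by ring.
by apply: H; rewrite lerN2.
Qed.

Lemma real_primitive_div c r F : 0 < c -> real_primitive r F ->
  real_primitive (fun s => r (s / c)) (fun s => c * F (s / c)).
Proof.
move=> c0 pF e /pF[d d0 H]; exists (d * c); first by rewrite mulr_gt0.
have ci0 : 0 <= c^-1 by rewrite invr_ge0 ltW.
move=> x u y xu uy yxd.
have E : y - x = c * (y / c - x / c) by field; rewrite gt_eqF.
rewrite E -mulrA -!mulrBr normrM gtr0_norm// mulrCA ler_wpM2l ?(ltW c0)//.
by apply: H; rewrite ?ler_wpM2r// -mulrBl ler_pdivrMr.
Qed.

(** By semi-additivity [w Y - w X <= w (Y - X)], so smallness of [w] near 0 gives continuity uniform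
    on the half-line. *)
Lemma real_primitive_modulus (w : R -> R) : modulus_of_continuity w ->
  real_primitive (fun s => w (Num.max s 0)) (fun s => Iomega w (Num.max s 0)).
Proof.
move=> mw e /(modulus_small mw)[d d0 H]; exists d => // x u y xu uy yxd.
set X := Num.max x 0; set U := Num.max u 0; set Y := Num.max y 0.
have X0 : 0 <= X by rewrite le_max lexx orbT.
have U0 : 0 <= U by rewrite le_max lexx orbT.
have Y0 : 0 <= Y by rewrite le_max lexx orbT.
have XU : X <= U by rewrite ge_max !le_max xu lexx !orbT.
have UY : U <= Y by rewrite ge_max !le_max uy lexx !orbT.
have YX : Y - X <= y - x by rewrite /X /Y; case: (leP x 0); case: (leP y 0); lra.
(* If [x] is not positive, clipping may shorten the segment, but then [w X = w 0 = 0]. *)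
have wX : (y - x) * w X <= (Y - X) * w X.
  rewrite /X /Y; case: (leP x 0) => x0; first by rewrite (modulus0 mw) !mulr0.
  by rewrite (max_idPl _)//; lra.
have /andP[h1 h2] := Iomega_bounds mw X0 (le_trans XU UY).
have wXU := modulus_homo mw X0 XU; have wUY := modulus_homo mw U0 UY.
have wYX := modulus_increment mw X0 (le_trans XU UY).
have wYXe : w (Y - X) <= e by apply: H; lra.
have wY0 := modulus_ge0 mw Y0.
have yx0 : 0 <= y - x by lra.
have h3 : (Y - X) * w Y <= (y - x) * w Y by rewrite ler_wpM2r.
have h4 : (y - x) * w X <= (y - x) * w U by rewrite ler_wpM2l.
have h5 : (y - x) * w U <= (y - x) * w Y by rewrite ler_wpM2l.
have h6 : (y - x) * w Y <= (y - x) * (w X + e) by rewrite ler_wpM2l//; lra.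
rewrite mulrDr in h6.
by rewrite ler_norml; lra.
Qed.

End RealPrimitive.

(** * Isometric additive copies of the real line *)

Section Line.
Context (R : realType) (X : lspaceType R).
Hypothesis iso : isotropic X.

Local Notation dist x y := (mdist (x : X) (y : X) : R).

(** Scaling is required only for [c >= 0], since multiplication by -1 need not give the additive
    inverse: on the reals, [a *:: x := |a| x] satisfies all the axioms. *)
Record line_embedding (L : R -> X) : Prop := {
  line_add : forall x y, L (x + y) = L x +:: L y;
  line_convex : forall x, convex_elements X (L x);
  line_scale : forall c x, 0 <= c -> c *:: L x = L (c * x);
  line_dist : forall x y, dist (L x) (L y) = `|x - y|
}.

Lemma line_embedding_exists :
  invertible_elements X `&` convex_elements X <> [set theta] ->
  exists L, line_embedding L.
Proof.
move=> nontriv.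
have [e0 [[[f0 ef0] ec0] e0n]] : exists e, (invertible_elements X `&` convex_elements X) e
    /\ e != theta.
  apply: contrapT => H; apply: nontriv; apply/seteqP; split => x /=.
    move=> xx; apply: contrapT => /eqP xn; apply: H; by exists x.
  move=> ->; split; last exact: theta_convex.
  by exists theta; exact: sadd0.
(* The inverse of a convex element is convex: add [(a + b) *:: e0] to both sides and cancel. *)
have f0c : convex_elements X f0.
  move=> a b a0 b0; apply: (@sadd_injl _ _ iso ((a + b) *:: e0)).
  rewrite -sscaleDr ef0 sscale_theta ec0// saddACA -!sscaleDr ef0.
  by rewrite !sscale_theta sadd0.
have n0 : 0 < dist e0 theta by rewrite mdist_gt0.
pose k := (dist e0 theta)^-1; have k0 : 0 <= k by rewrite invr_ge0 ltW.
pose e := k *:: e0; pose f := k *:: f0.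
have ec : convex_elements X e by exact: convex_scale.
have fc : convex_elements X f by apply: convex_scale.
have ef : e +:: f = theta by rewrite -sscaleDr ef0 sscale_theta.
have e1 : dist e theta = 1.
  by rewrite -/(xnorm e) xnorm_scale// /xnorm mulVf// gt_eqF.
have f1 : dist f theta = 1.
  by rewrite -(iso _ _ e) sadd0l saddC ef metric_sym.
(* Positive reals run along [e], negative ones along its inverse [f]. *)
pose L x := Num.max x 0 *:: e +:: Num.max (- x) 0 *:: f.
have max0 (x : R) : 0 <= Num.max x 0 by rewrite le_max lexx orbT.
have aux1 p n d : 0 <= p -> 0 <= n -> 0 <= d ->
    (p + d) *:: e +:: (n + d) *:: f = p *:: e +:: n *:: f.
  move=> p0 n0' d0; rewrite ec// fc// saddACA -sscaleDr ef sscale_theta.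
  by rewrite sadd0.
have aux p n p' n' : 0 <= p -> 0 <= n -> 0 <= p' -> 0 <= n' -> p - n = p' - n' ->
    p *:: e +:: n *:: f = p' *:: e +:: n' *:: f.
  move=> p0 n0' p'0 n'0 E; have [pp|pp] := leP p p'.
    have -> : p' = p + (p' - p) by ring.
    have -> : n' = n + (p' - p) by lra.
    by rewrite aux1// subr_ge0.
  have -> : p = p' + (p - p') by ring.
  have -> : n = n' + (p - p') by lra.
  by rewrite aux1// subr_ge0 ltW.
(* Any representation of [x] as a difference of non-negative reals yields [L x], because equal
   amounts of [e] and [f] cancel; additivity and scaling then need no distinction of signs. *)
have LE x p n : 0 <= p -> 0 <= n -> x = p - n -> L x = p *:: e +:: n *:: f.
  move=> p0 n0' ->; apply: aux => //.
  by case: (leP (p - n) 0); case: (leP (- (p - n)) 0); lra.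
have maxE (x : R) : x = Num.max x 0 - Num.max (- x) 0.
  by case: (leP x 0); case: (leP (- x) 0); lra.
have Ladd x y : L (x + y) = L x +:: L y.
  rewrite (@LE _ (Num.max x 0 + Num.max y 0) (Num.max (- x) 0 + Num.max (- y) 0)).
  - by rewrite ec// fc// saddACA.
  - exact: addr_ge0.
  - exact: addr_ge0.
  - by rewrite {1}(maxE x) {1}(maxE y); ring.
have L0 : L 0 = theta by rewrite (@LE 0 0 0) ?subrr// !sscale0 sadd0.
exists L; split => //.
- move=> x a b a0 b0; rewrite !sscaleDr saddACA.
  by congr (_ +:: _); apply: convex_scale.
- move=> c x c0; rewrite (@LE (c * x) (c * Num.max x 0) (c * Num.max (- x) 0)).
  + by rewrite sscaleDr !sscaleA.
  + exact: mulr_ge0.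
  + exact: mulr_ge0.
  + by rewrite {1}(maxE x) mulrBr.
- move=> x y; rewrite -[in L x](subrK y x) Ladd -{2}[L y]sadd0l iso.
  have [xy|xy] := leP 0 (x - y).
    rewrite (@LE (x - y) (x - y) 0) ?subr0// sscale0 sadd0.
    by rewrite -/(xnorm _) xnorm_scale// /xnorm e1 mulr1 ger0_norm.
  have yx0 : 0 <= - (x - y) by rewrite oppr_ge0 ltW.
  rewrite (@LE (x - y) 0 (- (x - y))) ?sub0r ?opprK// sscale0 sadd0l.
  by rewrite -/(xnorm _) xnorm_scale// /xnorm f1 mulr1 ltr0_norm.
Qed.

(** Both sides have the same first-order increments, so [increment_le] applies to their distance
    with the zero function as bound. *)
Lemma line_primitive (L : R -> X) (a b x y : R) (f : R -> X) (J : R -> R -> X)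
    (r F : R -> R) :
  line_embedding L -> is_primitive a b f J -> real_primitive r F ->
  a <= x -> x <= y -> y <= b ->
  (forall s, x <= s -> s <= y -> f s = L (r s)) ->
  J x y = L (F y - F x).
Proof.
move=> eL Jp pF ax xy yb fr; have [Jadd Jloc] := Jp.
pose D v := dist (J x (x + v)) (L (F (x + v) - F x)).
have D0 : D 0 = 0.
  rewrite /D addr0 subrr (is_primitive_refl _ _ Jp) ?(le_trans xy)//.
  by rewrite -(sscale0 (L 0)) (line_scale eL)// mul0r mdistxx.
apply: mdist_positivity; apply/eqP; rewrite eq_le mdist_ge0 andbT.
pose Z : R -> R := fun=> 0.
have : D (y - x) - D 0 <= Z (y - x) - Z 0.
  apply: increment_le => [|e e0]; first by rewrite subr_ge0.
  have e20 : 0 < e / 2 by rewrite divr_gt0.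
  have [d d0 H] := Jloc _ e20; have [d' d'0 H'] := pF _ e20.
  exists (Num.min d d'); first by rewrite lt_min d0.
  move=> v h v0 h0; rewrite le_min => /andP[hd hd'] vhy /=.
  have E : J x (x + (v + h)) = J x (x + v) +:: J (x + v) (x + v + h).
    by rewrite addrA; apply: Jadd; lra.
  have E' : L (F (x + (v + h)) - F x) =
      L (F (x + v) - F x) +:: L (F (x + v + h) - F (x + v)).
    by rewrite -(line_add eL) addrA; congr L; ring.
  have := H (x + v) (x + v) (x + v + h).
  rewrite (_ : x + v + h - (x + v) = h); last by ring.
  rewrite fr ?(line_scale eL)//; [|lra|lra] => HJ.
  have {}HJ : dist (J (x + v) (x + v + h)) (L (h * r (x + v))) <= e / 2 * h.
    by apply: HJ; lra.
  have := H' (x + v) (x + v) (x + v + h).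
  rewrite (_ : x + v + h - (x + v) = h); last by ring.
  rewrite lerDl => /(_ (lexx _) h0 hd'); rewrite -(line_dist eL) => HF.
  have := dist_add_le (J x (x + v)) (J (x + v) (x + v + h))
    (L (F (x + v) - F x)) (L (F (x + v + h) - F (x + v))).
  rewrite -E -E' -!/(D _) => hD.
  have := metric_triangle (J (x + v) (x + v + h)) (L (h * r (x + v)))
    (L (F (x + v + h) - F (x + v))).
  rewrite (metric_sym (L (h * r _))) => hT.
  rewrite /Z subrr add0r.
  move: hD hT HJ HF; rewrite -/(D v) -/(D (v + h)); lra.
rewrite D0 !subr0 /D addrC subrK.
exact.
Qed.

End Line.

(** * Hukuhara derivatives and the two inequalities *)

Section Derivative.
Context (R : realType) (X : lspaceType R) (P : X -> X) (w : R -> R) (a b : R).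
Hypothesis iso : isotropic X.
Hypothesis cP : convexifying P.
Hypothesis mw : modulus_of_continuity w.
Hypothesis wn0 : exists2 s, 0 <= s & w s != 0.
Hypothesis ab : a < b.
Implicit Types (f psi : R -> X) (J : R -> R -> X).

Local Notation dist x y := (mdist (x : X) (y : X) : R).

Lemma Homega_uniformly_continuous (phi : R -> X) :
  Homega w a b phi -> uniformly_continuous_on a b phi.
Proof.
move=> Hphi e /(modulus_small mw)[d d0 H]; exists d => // s s' sab s'ab ss'.
by rewrite (le_trans (Hphi _ _ sab s'ab))// H// ltW.
Qed.

(** Simple integrals sum [P] of the values, so the integral of [phi] is a primitive of
    [P \o phi]. *)
Lemma lintegral_primitive (phi : R -> X) : Homega w a b phi ->
  is_primitive a b (P \o phi) (fun x y => lintegral P x y phi).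
Proof.
move=> Hphi; have uphi := Homega_uniformly_continuous Hphi; split.
  move=> x y z ax xy yz zb; apply: lintegralD => //.
  exact: uniformly_continuous_sub uphi.
move=> e /(modulus_small mw)[d d0 H]; exists d => // x u y ax xu uy yb yxd.
have xy := le_trans xu uy.
rewrite [e * _]mulrC; apply: lintegral_cst_dist => //.
  exact: uniformly_continuous_sub uphi.
move=> s; rewrite in_itv /= => /andP[xs sy].
apply: (le_trans (Hphi _ _ _ _)); rewrite ?in_itv /=.
- by rewrite (le_trans ax) ?(le_trans sy).
- by rewrite (le_trans ax) ?(le_trans uy).
- by apply: H => //; rewrite ler_norml; apply/andP; split; lra.
Qed.

Lemma is_primitiveZ k psi J : 0 <= k -> is_primitive a b psi J ->
  is_primitive a b (fun s => k *:: psi s) (fun x y => k *:: J x y).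
Proof.
move=> k0 [Jadd Jloc]; split.
  by move=> x y z *; rewrite (Jadd x y z)// sscaleDr.
move=> e e0; have e'0 : 0 < e / (k + 1) by rewrite divr_gt0//; lra.
have [d d0 H] := Jloc _ e'0; exists d => // x u y ax xu uy yb yxd.
rewrite sscaleA [_ * k]mulrC -sscaleA dist_scale_ge0//.
apply: (le_trans (ler_wpM2l k0 (H x u y ax xu uy yb yxd))).
rewrite mulrA ler_wpM2r//; first by lra.
by rewrite mulrCA -{2}(mulr1 e) ler_wpM2l ?(ltW e0)// ler_pdivrMr; lra.
Qed.

Lemma W1Homega_bar_primitive f : W1Homega_bar P w a b f ->
  exists psi J k, [/\ is_primitive a b psi J,
    forall s, convex_elements X (psi s),
    forall s s', s \in `[a, b] -> s' \in `[a, b] ->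
      dist (psi s) (psi s') <= k * w `|s - s'| &
    forall x y, a <= x -> x <= y -> y <= b -> f y = f x +:: J x y].
Proof.
move=> [k [g [k0 [phi [x0 [Hphi _ gE]]] fE]]].
have pJ := lintegral_primitive Hphi.
exists (fun s => k *:: P (phi s)), (fun x y => k *:: lintegral P x y phi), k.
have k0' := ltW k0; split.
- exact: is_primitiveZ pJ.
- by move=> s; apply: convex_scale => //; exact: convexifying_convex.
- move=> s s' sab s'ab; rewrite dist_scale_ge0// ler_wpM2l//.
  by rewrite (le_trans (convexifying_nonexpansive cP _ _))// Hphi.
- move=> x y ax xy yb; have [Jadd _] := pJ.
  have xab : x \in `[a, b] by rewrite in_itv /= ax (le_trans xy).
  have yab : y \in `[a, b] by rewrite in_itv /= yb (le_trans ax).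
  rewrite (fE x xab) (fE y yab) (gE x xab) (gE y yab).
  by rewrite (Jadd a x y (lexx a) ax xy yb) saddA sscaleDr.
Qed.

Section Primitive.
Variables (f psi : R -> X) (J : R -> R -> X).
Hypothesis pJ : is_primitive a b psi J.
Hypothesis fJ : forall x y, a <= x -> x <= y -> y <= b -> f y = f x +:: J x y.

Lemma divided_hdiff_primitive t g1 g2 : a <= t - g1 -> 0 <= g1 + g2 ->
  t + g2 <= b -> divided_hdiff g1 g2 f t = (g1 + g2)^-1 *:: J (t - g1) (t + g2).
Proof.
by move=> h1 h2 h3; rewrite /divided_hdiff (hdiff_eq iso (fJ _ _ _))//; lra.
Qed.

Lemma is_hderive_primitive s : s \in `[a, b] -> is_hderive a b f s (psi s).
Proof.
rewrite in_itv /= => /andP[as_ sb].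
have near_le c : 0 < c -> \forall g \near 0^'+, 0 < g <= c.
  move=> c0; near=> g; apply/andP; split; first by near: g; exact: nbhs_right_gt.
  by near: g; exact: nbhs_right_le.
have [_ Jloc] := pJ.
split => [s_b|a_s]; split.
- have : 0 < b - s by rewrite subr_gt0.
  move=> /near_le; apply: filterS => g /andP[g0 gb].
  by exists (J s (s + g)); apply: fJ; lra.
- apply/metricType_numDomainType.cvgrPdist_le => e /Jloc[d d0 H].
  have : 0 < Num.min d (b - s) by rewrite lt_min d0 subr_gt0.
  move=> /near_le; apply: filterS => g /andP[g0]; rewrite le_min => /andP[gd gb].
  rewrite (hdiff_eq iso (fJ _ _ _)); [|lra..].
  have -> : psi s = g^-1 *:: (g *:: psi s).
    by rewrite sscaleA mulVf ?sscale1// gt_eqF.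
  rewrite dist_scale_ge0 ?invr_ge0 ?(ltW g0)// ler_pdivrMl//.
  have := H s s (s + g); rewrite (_ : s + g - s = g); last by ring.
  by rewrite metric_sym [g * e]mulrC; apply; lra.
- have : 0 < s - a by rewrite subr_gt0.
  move=> /near_le; apply: filterS => g /andP[g0 gb].
  by exists (J (s - g) s); apply: fJ; lra.
- apply/metricType_numDomainType.cvgrPdist_le => e /Jloc[d d0 H].
  have : 0 < Num.min d (s - a) by rewrite lt_min d0 subr_gt0.
  move=> /near_le; apply: filterS => g /andP[g0]; rewrite le_min => /andP[gd gb].
  rewrite (hdiff_eq iso (fJ _ _ _)); [|lra..].
  have -> : psi s = g^-1 *:: (g *:: psi s).
    by rewrite sscaleA mulVf ?sscale1// gt_eqF.
  rewrite dist_scale_ge0 ?invr_ge0 ?(ltW g0)// ler_pdivrMl//.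
  have := H (s - g) s s; rewrite (_ : s - (s - g) = g); last by ring.
  by rewrite metric_sym [g * e]mulrC; apply; lra.
Unshelve. all: by end_near. Qed.

Lemma hderive_primitive s : s \in `[a, b] -> hderive a b f s = psi s.
Proof.
move=> sab; have Dpsi := is_hderive_primitive sab.
apply: xget_unique => // d [Rd Ld]; case: Dpsi => [Rpsi Lpsi].
have haus := @metric_hausdorff R X.
move: sab; rewrite in_itv /= => /andP[as_ sb].
have [s_b|bs] := ltP s b.
  exact: (cvg_unique haus (Rd s_b).2 (Rpsi s_b).2).
have a_s : a < s by exact: lt_le_trans bs.
exact: (cvg_unique haus (Ld a_s).2 (Lpsi a_s).2).
Qed.

End Primitive.

(** The supremum is finite by the bound [k], non-negative because [a < b] provides two distinct
    points, and itself an admissible constant because [w] is positive off 0. *)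
Lemma omega_norm_fin (D : R -> X) k :
  (forall s s', s \in `[a, b] -> s' \in `[a, b] ->
     dist (D s) (D s') <= k * w `|s - s'|) ->
  exists W, [/\ 0 <= W, W <= k, omega_norm w a b D = W%:E &
    forall s s', s \in `[a, b] -> s' \in `[a, b] ->
      dist (D s) (D s') <= W * w `|s - s'|].
Proof.
move=> Dk; have w0 (s s' : R) : s != s' -> 0 < w `|s - s'|.
  by move=> ss'; apply: (modulus_gt0 mw wn0); rewrite normr_gt0 subr_eq0.
have le_k : (omega_norm w a b D <= k%:E)%E.
  apply: ge_ereal_sup => _ [[s s'] /= [sab s'ab ss'] <-].
  by rewrite lee_fin ler_pdivrMr ?w0// Dk.
have ge (s s' : R) : s \in `[a, b] -> s' \in `[a, b] -> s != s' ->
    ((dist (D s) (D s') / w `|s - s'|)%:E <= omega_norm w a b D)%E.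
  by move=> sab s'ab ss'; apply: ereal_sup_ubound; exists (s, s').
have ge0 : (0 <= omega_norm w a b D)%E.
  have aab : a \in `[a, b] by rewrite in_itv /= lexx ltW.
  have bab : b \in `[a, b] by rewrite in_itv /= lexx ltW.
  have abn : a != b by rewrite lt_eqF.
  apply: le_trans (ge a b aab bab abn); rewrite lee_fin divr_ge0 ?mdist_ge0//.
  by rewrite ltW// w0.
have fin : omega_norm w a b D \is a fin_num.
  by rewrite ge0_fin_numE// (le_lt_trans le_k)// ltry.
exists (fine (omega_norm w a b D)); split.
- exact: fine_ge0.
- by rewrite -lee_fin fineK.
- by rewrite fineK.
- move=> s s' sab s'ab; have [->|ss'] := eqVneq s s'.
    by rewrite mdistxx subrr normr0 (modulus0 mw) mulr0.
  by rewrite -ler_pdivrMr ?w0// -lee_fin fineK// ge.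
Qed.

End Derivative.

(** * Distance between two means, and between a value and a mean *)

Section Inequalities.
Context (R : realType) (X : lspaceType R) (w : R -> R) (a b t W : R).
Variables (psi : R -> X) (J : R -> R -> X).
Hypothesis mw : modulus_of_continuity w.
Hypothesis W0 : 0 <= W.
Hypothesis pJ : is_primitive a b psi J.
Hypothesis psi_convex : forall s, convex_elements X (psi s).
Hypothesis psiW : forall s s', s \in `[a, b] -> s' \in `[a, b] ->
  mdist (psi s) (psi s') <= W * w `|s - s'|.

Local Notation dist x y := (mdist (x : X) (y : X) : R).

Let I_incr x y : 0 <= x -> x <= y -> (y - x) * w x <= Iomega w y - Iomega w x.
Proof. by move=> x0 xy; have /andP[] := Iomega_bounds mw x0 xy. Qed.

Let psi_dist s s' : a <= s -> s <= s' -> s' <= b ->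
  dist (psi s) (psi s') <= W * w (s' - s).
Proof.
move=> as_ ss' s'b.
have := @psiW s s'; rewrite !in_itv /= as_ s'b (le_trans as_ ss') (le_trans ss' s'b).
by rewrite distrC ger0_norm ?subr_ge0//; apply.
Qed.

Let psi_dist_opp s s' : - b <= s -> s <= s' -> s' <= - a ->
  dist ((psi \o -%R) s) ((psi \o -%R) s') <= W * w (s' - s).
Proof.
move=> bs ss' s'a; rewrite /= metric_sym (_ : s' - s = - s - - s'); last by ring.
by apply: psi_dist; lra.
Qed.

Lemma divided_mean_dist g1 g2 h1 h2 :
  0 < g1 + g2 -> g1 <= h1 -> g2 <= h2 -> a <= t - h1 -> t + h2 <= b ->
  dist ((g1 + g2)^-1 *:: J (t - g1) (t + g2))
       ((h1 + h2)^-1 *:: J (t - h1) (t + h2)) <= Komega w g1 g2 h1 h2 * W.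
Proof.
move=> G0 g1h1 g2h2 ah1 h2b.
(* If nothing is to be transported, both intervals coincide and [Komega] is 0. *)
have [S0|S0] := leP ((h1 - g1) + (h2 - g2)) 0.
  have -> : h1 = g1 by lra.
  have -> : h2 = g2 by lra.
  by rewrite /Komega !subrr addr0 !mul0r mdistxx.
rewrite /Komega; set A := h1 - g1; set B := h2 - g2; set S := A + B in S0 *.
set G := g1 + g2.
have A0 : 0 <= A by rewrite subr_ge0.
have B0 : 0 <= B by rewrite subr_ge0.
have HE : h1 + h2 = G + S by rewrite /G /S /A /B; ring.
rewrite HE; pose p := t - g1; pose q := t + g2.
have -> : t - h1 = p - A by rewrite /p /A; ring.
have -> : t + h2 = q + B by rewrite /q /B; ring.
rewrite -/p -/q.
(* The point where U is cut: the images of the left and the right piece have lengths [A * (G / S)]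
   and [B * (G / S)], with sum [G]. *)
have cE : p + A * (G / S) = q - B * (G / S).
  have -> : q = p + (A + B) * (G / S).
    by rewrite -/S /q /p mulrC divfK ?gt_eqF// /G; ring.
  by ring.
have AGS : 0 <= A * (G / S) by apply: mulr_ge0 => //; apply: divr_ge0; apply: ltW.
have BGS : 0 <= B * (G / S) by apply: mulr_ge0 => //; apply: divr_ge0; apply: ltW.
have pA : a <= p - A by rewrite /p /A; lra.
have qB : q + B <= b by rewrite /q /B; lra.
have left_half := primitive_transport (Iomega0 w) I_incr W0 A0 G0 S0 pA
  (b := b) (f := psi) (J := J).
rewrite -/G in left_half.
have {}left_half := left_half _ pJ (fun s _ _ => psi_convex s) psi_dist.
have {left_half} := left_half ltac:(lra); cbv zeta; set J1 := J p _ => left_half.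
(* The right piece is the left piece of the reflected problem. *)
have right_half := primitive_transport (Iomega0 w) I_incr W0 B0 G0 S0
  (a := - b) (b := - a) (p := - q) (f := psi \o -%R)
  (J := fun x y => J (- y) (- x)).
have {right_half} := right_half ltac:(lra) ltac:(rewrite -/G; lra)
  (is_primitive_opp pJ) (fun s _ _ => psi_convex _) psi_dist_opp.
rewrite -/G; cbv zeta.
have -> : - (- q + B * (G / S)) = p + A * (G / S) by rewrite cE; ring.
have -> : - (- q - B) = q + B by ring.
rewrite opprK; set J2 := J _ q => right_half.
have [Jadd _] := pJ.
have E1 : J p q = J1 +:: J2 by apply: Jadd; lra.
have E2 : J (p - A) (q + B) = (J1 +:: J (p - A) p) +:: (J2 +:: J q (q + B)).
  have -> : J (p - A) (q + B) = J (p - A) p +:: J p (q + B) by apply: Jadd; lra.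
  have -> : J p (q + B) = J p q +:: J q (q + B) by apply: Jadd; lra.
  by rewrite E1 (saddC J1 (J (p - A) p)) !saddA.
rewrite E1 E2 !sscaleDr; apply: (le_trans (dist_add_le _ _ _ _)).
by rewrite -!sscaleDr; lra.
Qed.

(** The interval is split at [t], and convexity of [psi t] splits the value in the proportions [h1]
    and [h2]. *)
Lemma value_mean_dist h1 h2 : 0 <= h1 -> 0 <= h2 -> 0 < h1 + h2 ->
  a <= t - h1 -> t + h2 <= b ->
  dist (psi t) ((h1 + h2)^-1 *:: J (t - h1) (t + h2)) <=
    (Iomega w h1 + Iomega w h2) / (h1 + h2) * W.
Proof.
move=> h10 h20 H0 ah hb; have [Jadd _] := pJ.
have at_ : a <= t by lra.
have tb : t <= b by lra.
have right_half := primitive_value_dist (Iomega0 w) I_incr W0 h20 at_ hb pJ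
  (psi_convex t) psi_dist.
have left_half := primitive_value_dist (Iomega0 w) I_incr W0 h10
  (a := - b) (b := - a) (t := - t) (f := psi \o -%R)
  (J := fun x y => J (- y) (- x)).
have {left_half} := left_half ltac:(lra) ltac:(lra) (is_primitive_opp pJ)
  (psi_convex _) psi_dist_opp.
rewrite /= opprK (_ : - (- t + h1) = t - h1); last by ring.
move=> left_half.
have -> : psi t = (h1 + h2)^-1 *:: (h1 *:: psi t +:: h2 *:: psi t).
  by rewrite -psi_convex// sscaleA mulVf ?sscale1// gt_eqF.
rewrite dist_scale_ge0 ?invr_ge0 ?(ltW H0)//.
have -> : (Iomega w h1 + Iomega w h2) / (h1 + h2) * W =
    (h1 + h2)^-1 * (Iomega w h1 * W + Iomega w h2 * W) by ring.
apply: ler_wpM2l; first by rewrite invr_ge0 ltW.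
rewrite (Jadd _ t); [|lra..].
by rewrite (le_trans (dist_add_le _ _ _ _))// lerD.
Qed.

End Inequalities.

(** * Extremal functions *)

Section Extremal.
Context (R : realType) (w : R -> R).
Hypothesis mw : modulus_of_continuity w.

Local Notation I := (Iomega w).

(* Extends [w], whose values at negative arguments are arbitrary, by 0. *)
Definition pos_modulus (s : R) := w (Num.max s 0).

Lemma pos_modulus_increment x y : x <= y ->
  0 <= pos_modulus y - pos_modulus x <= w (Num.max y 0 - Num.max x 0).
Proof.
move=> xy; rewrite /pos_modulus.
have x0 : 0 <= Num.max x 0 by rewrite le_max lexx orbT.
have xy0 : Num.max x 0 <= Num.max y 0 by rewrite ge_max !le_max xy lexx !orbT.
have := modulus_increment mw x0 xy0; have := modulus_homo mw x0 xy0.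
by lra.
Qed.

Lemma maxr_increment (x y : R) : x <= y ->
  (Num.max y 0 - Num.max x 0) + (Num.max (- x) 0 - Num.max (- y) 0) = y - x.
Proof.
by move=> xy; case: (leP y 0); case: (leP x 0); case: (leP (- x) 0);
  case: (leP (- y) 0); lra.
Qed.

Lemma maxr_homo (x y : R) : x <= y -> Num.max x 0 <= Num.max y 0.
Proof. by move=> xy; rewrite ge_max !le_max xy lexx !orbT. Qed.

Definition within_modulus (r : R -> R) :=
  forall s s', `|r s - r s'| <= w `|s - s'|.

Lemma within_modulusP (r : R -> R) :
  (forall s s', s <= s' -> `|r s' - r s| <= w (s' - s)) -> within_modulus r.
Proof.
move=> H s s'; have [ss'|/ltW s's] := leP s s'.
  by rewrite distrC [X in w X]distrC (ger0_norm (x := s' - s)) ?subr_ge0// H.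
by rewrite (ger0_norm (x := s - s')) ?subr_ge0// H.
Qed.

(** On a step to the right the term in [t - s] raises the tent and the term in [s - t] lowers it.
    Each change lies between 0 and [w (s' - s)], so their difference stays within that bound for
    every modulus, also across the peak. *)
Lemma within_modulus_tent t C :
  within_modulus (fun s => C - pos_modulus (s - t) - pos_modulus (t - s)).
Proof.
apply: within_modulusP => s s' ss'.
have st : s - t <= s' - t by rewrite lerD2r.
have ts : t - s' <= t - s by rewrite lerD2l lerN2.
have /andP[h1 h2] := pos_modulus_increment st.
have /andP[h3 h4] := pos_modulus_increment ts.
have E : (Num.max (s' - t) 0 - Num.max (s - t) 0) +
    (Num.max (t - s) 0 - Num.max (t - s') 0) = s' - s.
  by rewrite -(opprB s t) -(opprB s' t) maxr_increment//; ring.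
have m1 := maxr_homo ts; have m2 := maxr_homo st.
have h5 : w (Num.max (s' - t) 0 - Num.max (s - t) 0) <= w (s' - s).
  by apply: (modulus_homo mw); lra.
have h6 : w (Num.max (t - s) 0 - Num.max (t - s') 0) <= w (s' - s).
  by apply: (modulus_homo mw); lra.
by rewrite ler_norml; lra.
Qed.

Section Ramp.
Variable l : R.
Hypothesis l01 : 0 < l < 1.
Hypothesis cw : concave_modulus w.

Let l0 : 0 < l. Proof. by case/andP: l01. Qed.
Let l'0 : 0 < 1 - l. Proof. by rewrite subr_gt0; case/andP: l01. Qed.

(* On the two sides of 0 the slopes are scaled so that the points [v * l] and
   [- v * (1 - l)], matched by the transport, have values exactly [w v] apart;
   concavity of [w] keeps the function within the modulus [w]. *)
Definition ramp s :=
  l * pos_modulus (s / l) + - (1 - l) * pos_modulus (- (s / (1 - l))).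

(** Left unsimplified: the outer factors are the coefficients in [ramp], the inner ones come from
    rescaling the argument, and the inner minus sign from its reflection. *)
Definition ramp_primitive s :=
  l * (l * I (Num.max (s / l) 0)) +
  - (1 - l) * ((1 - l) * - I (Num.max (- (s / (1 - l))) 0)).

Lemma ramp_primitiveP : real_primitive ramp ramp_primitive.
Proof.
have pm := real_primitive_modulus mw.
apply: real_primitiveD; apply: real_primitiveZ.
  exact: (real_primitive_div l0 pm).
exact: (real_primitive_div l'0 (real_primitive_opp pm)).
Qed.

Lemma maxr_div (c s : R) : 0 < c -> c * Num.max (s / c) 0 = Num.max s 0.
Proof. by move=> c0; rewrite maxr_pMr ?ltW// mulr0 mulrC divfK ?gt_eqF. Qed.

Lemma maxr_divN (c s : R) : 0 < c ->
  c * Num.max (- (s / c)) 0 = Num.max (- s) 0.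
Proof. by move=> c0; rewrite -mulNr maxr_div. Qed.

(** The parts of the step on the two sides of 0, divided by [l] and [1 - l], are averaged with
    weights [l] and [1 - l]. Concavity bounds the average of the moduli by [w] of the average, which
    is [y - x]. *)
Lemma ramp_increment x y : x <= y -> 0 <= ramp y - ramp x <= w (y - x).
Proof.
move=> xy; have xl : x / l <= y / l by rewrite ler_wpM2r// invr_ge0 ltW.
have xl' : - (y / (1 - l)) <= - (x / (1 - l)).
  by rewrite lerN2 ler_wpM2r// invr_ge0 ltW.
have /andP[h1 h2] := pos_modulus_increment xl.
have /andP[h3 h4] := pos_modulus_increment xl'.
rewrite /ramp; set u := pos_modulus (y / l) in h1 h2 *.
set u' := pos_modulus (x / l) in h1 h2 *.
set v := pos_modulus (- (x / (1 - l))) in h3 h4 *.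
set v' := pos_modulus (- (y / (1 - l))) in h3 h4 *.
have h1' : 0 <= l * (u - u') by rewrite mulr_ge0// ltW.
have h3' : 0 <= (1 - l) * (v - v') by rewrite mulr_ge0// ltW.
have h2' := ler_wpM2l (ltW l0) h2; have h4' := ler_wpM2l (ltW l'0) h4.
have l01' : 0 <= l <= 1 by case/andP: l01 => /ltW-> /ltW->.
have := concave_modulusP cw l01' (x := Num.max (y / l) 0 - Num.max (x / l) 0)
  (y := Num.max (- (x / (1 - l))) 0 - Num.max (- (y / (1 - l))) 0).
rewrite !mulrBr !maxr_div// !maxr_divN// maxr_increment// !subr_ge0.
move=> /(_ (maxr_homo xl) (maxr_homo xl')) h5.
move: h1' h2' h3' h4' h5.
by rewrite !mulrBr !mulNr; lra.
Qed.

Lemma ramp_pos A : 0 <= A -> ramp (A * l) = l * w A.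
Proof.
move=> A0; rewrite /ramp /pos_modulus mulfK ?gt_eqF// (max_idPl A0).
rewrite (max_idPr _) ?(modulus0 mw) ?mulr0 ?addr0//.
by rewrite oppr_le0; apply: divr_ge0; [apply: mulr_ge0 => //|]; apply: ltW.
Qed.

Lemma ramp_primitive0 : ramp_primitive 0 = 0.
Proof. by rewrite /ramp_primitive !mul0r oppr0 maxxx Iomega0; ring. Qed.

Lemma ramp_primitive_pos A : 0 <= A -> ramp_primitive (A * l) = l ^+ 2 * I A.
Proof.
move=> A0; rewrite /ramp_primitive mulfK ?gt_eqF// (max_idPl A0).
rewrite (max_idPr _) ?Iomega0; first by ring.
by rewrite oppr_le0; apply: divr_ge0; [apply: mulr_ge0 => //|]; apply: ltW.
Qed.

Lemma ramp_primitive_neg A : 0 <= A ->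
  ramp_primitive (- (A * (1 - l))) = (1 - l) ^+ 2 * I A.
Proof.
move=> A0; rewrite /ramp_primitive !mulNr mulfK ?gt_eqF// opprK (max_idPl A0).
rewrite (max_idPr _) ?Iomega0; first by ring.
by rewrite oppr_le0; apply: divr_ge0; [apply: mulr_ge0 => //|]; apply: ltW.
Qed.

(** On a step to the right one ramp rises and the other falls, each by at most [w (s' - s)], and a
    minimum moves no more than its arguments do. *)
Lemma within_modulus_ramps p q k1 k2 C : within_modulus (fun s =>
  Num.min (ramp (s - p) - k1) (ramp (q - s) - k2) + C).
Proof.
apply: within_modulusP => s s' ss'.
have sp : s - p <= s' - p by rewrite lerD2r.
have qs : q - s' <= q - s by rewrite lerD2l lerN2.
have := ramp_increment sp; have := ramp_increment qs.
rewrite (_ : q - s - (q - s') = s' - s); last by ring.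
rewrite (_ : s' - p - (s - p) = s' - s); last by ring.
set u := ramp (s' - p); set u' := ramp (s - p).
set v := ramp (q - s); set v' := ramp (q - s') => h1 h2.
rewrite ler_norml; apply/andP; split;
  case: (leP (u - k1) (v' - k2)); case: (leP (u' - k1) (v - k2)); lra.
Qed.

End Ramp.

Lemma Iomega_gt0 x : (exists2 s, 0 <= s & w s != 0) -> 0 < x -> 0 < I x.
Proof.
move=> wn0 x0; have x20 : 0 < x / 2 by rewrite divr_gt0.
have /andP[h1 _] := Iomega_bounds mw (lexx 0) (ltW x20).
have x2x : x / 2 <= x by lra.
have /andP[h2 _] := Iomega_bounds mw (ltW x20) x2x.
have := mulr_gt0 x20 (modulus_gt0 mw wn0 x20).
move: h1 h2; rewrite Iomega0 (modulus0 mw) subr0 mulr0.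
rewrite (_ : x - x / 2 = x / 2); last by field.
by lra.
Qed.

Lemma Iomega_ge0 x : 0 <= x -> 0 <= I x.
Proof.
move=> x0; have /andP[+ _] := Iomega_bounds mw (lexx 0) x0.
by rewrite Iomega0 !subr0 (modulus0 mw) mulr0.
Qed.

End Extremal.

(** * Integrals of the ramps along a line in X *)

Section RampIntegral.
Context (R : realType) (X : lspaceType R) (L : R -> X) (w : R -> R) (l : R).
Hypothesis mw : modulus_of_continuity w.
Hypothesis cw : concave_modulus w.
Hypothesis eL : line_embedding L.
Hypothesis l01 : 0 < l < 1.

Lemma ramp_integral a b p A C psi J : 0 <= A ->
  a <= p - A * (1 - l) -> p + A * l <= b -> is_primitive a b psi J ->
  (forall s, p - A * (1 - l) <= s -> s <= p + A * l ->
     psi s = L (ramp w l (s - p) + C)) ->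
  J (p - A * (1 - l)) p =
    L (C * (A * (1 - l)) - (1 - l) ^+ 2 * Iomega w A) /\
  J p (p + A * l) = L (l ^+ 2 * Iomega w A + C * (A * l)).
Proof.
move=> A0 ap pb pJ psiE.
have [l0 l1] : 0 < l /\ l < 1 by case/andP: l01.
have Al0 : 0 <= A * l by rewrite mulr_ge0// ltW.
have Al'0 : 0 <= A * (1 - l) by rewrite mulr_ge0// subr_ge0 ltW.
pose F s := ramp_primitive w l (s + - p) + C * s.
have pF : real_primitive (fun s => ramp w l (s + - p) + cst C s) F.
  apply: real_primitiveD (real_primitive_cst _).
  exact: (real_primitive_shift (- p) (ramp_primitiveP mw l01)).
have JF x y : p - A * (1 - l) <= x -> x <= y -> y <= p + A * l ->
    J x y = L (F y - F x).
  move=> px xy yp; apply: (line_primitive eL pJ pF) => //.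
  - exact: le_trans px.
  - exact: le_trans pb.
  - move=> s xs sy; rewrite psiE ?(le_trans px)//.
    exact: le_trans yp.
have Fp : F p = C * p by rewrite /F subrr ramp_primitive0; ring.
have pA : p - A * (1 - l) <= p by rewrite gerBl.
have pA' : p <= p + A * l by rewrite lerDl.
split; rewrite JF// Fp; congr L; rewrite /F.
- rewrite (_ : p - A * (1 - l) + - p = - (A * (1 - l))); last by ring.
  by rewrite ramp_primitive_neg//; ring.
- rewrite (_ : p + A * l + - p = A * l); last by ring.
  by rewrite ramp_primitive_pos//; ring.
Qed.

Lemma ramp_integral_opp a b q B C psi J : 0 <= B ->
  a <= q - B * l -> q + B * (1 - l) <= b -> is_primitive a b psi J ->
  (forall s, q - B * l <= s -> s <= q + B * (1 - l) ->
     psi s = L (ramp w l (q - s) + C)) ->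
  J q (q + B * (1 - l)) =
    L (C * (B * (1 - l)) - (1 - l) ^+ 2 * Iomega w B) /\
  J (q - B * l) q = L (l ^+ 2 * Iomega w B + C * (B * l)).
Proof.
move=> B0 aq qb pJ psiE.
have E1 : - q - B * (1 - l) = - (q + B * (1 - l)) by ring.
have E2 : - q + B * l = - (q - B * l) by ring.
have := ramp_integral (a := - b) (b := - a) (p := - q) (C := C) B0 _ _
  (is_primitive_opp pJ).
rewrite E1 E2 !lerN2 /= !opprK; apply => // s sq qs.
rewrite psiE; last 2 first.
- by rewrite lerNr.
- by rewrite lerNl.
by congr (L (ramp w l _ + C)); ring.
Qed.

(** The constants [l * w A] and [l * w B] are the ramp values at the cut [p + A * l = q - B * l], so
    both lowered ramps vanish there. To its left the first is non-positive and the second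
    non-negative, to its right conversely; hence the minimum is a single ramp on each side. *)
Lemma ramps_integral a b p q A B C J :
  0 <= A -> 0 <= B -> a <= p - A * (1 - l) -> q + B * (1 - l) <= b ->
  p + A * l = q - B * l ->
  is_primitive a b (L \o (fun s => Num.min (ramp w l (s - p) - l * w A)
    (ramp w l (q - s) - l * w B) + C)) J ->
  let IAB := Iomega w A + Iomega w B in
  let k := l * w A * A + l * w B * B in
  J p q = L (l ^+ 2 * IAB + C * (A + B) * l - k * l) /\
  J (p - A * (1 - l)) (q + B * (1 - l)) =
    L ((l ^+ 2 - (1 - l) ^+ 2) * IAB + C * (A + B) - k).
Proof.
move=> A0 B0 ap qb pq pJ IAB k.
have [l0 l1] : 0 < l /\ l < 1 by case/andP: l01.
have Al0 : 0 <= A * l by rewrite mulr_ge0// ltW.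
have Bl0 : 0 <= B * l by rewrite mulr_ge0// ltW.
have Al'0 : 0 <= A * (1 - l) by rewrite mulr_ge0// subr_ge0 ltW.
have Bl'0 : 0 <= B * (1 - l) by rewrite mulr_ge0// subr_ge0 ltW.
have rampA s : s - p <= A * l -> ramp w l (s - p) <= l * w A.
  by move=> /(ramp_increment mw l01 cw)/andP[+ _]; rewrite ramp_pos// subr_ge0.
have rampB s : q - s <= B * l -> ramp w l (q - s) <= l * w B.
  by move=> /(ramp_increment mw l01 cw)/andP[+ _]; rewrite ramp_pos// subr_ge0.
have rampA' s : A * l <= s - p -> l * w A <= ramp w l (s - p).
  by move=> /(ramp_increment mw l01 cw)/andP[+ _]; rewrite ramp_pos// subr_ge0.
have rampB' s : B * l <= q - s -> l * w B <= ramp w l (q - s).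
  by move=> /(ramp_increment mw l01 cw)/andP[+ _]; rewrite ramp_pos// subr_ge0.
set psi := L \o _ in pJ.
have [|s ps sp|Jl1 Jl2] := ramp_integral (p := p) (C := C - l * w A) A0 ap _ pJ.
- by rewrite pq; lra.
- have h1 := rampA s ltac:(lra); have h2 := rampB' s ltac:(lra).
  by rewrite /psi /= (min_idPl _); [congr L; ring|lra].
have [Jadd _] := pJ.
have Jr : J q (q + B * (1 - l)) =
    L ((C - l * w B) * (B * (1 - l)) - (1 - l) ^+ 2 * Iomega w B) /\
    J (q - B * l) q = L (l ^+ 2 * Iomega w B + (C - l * w B) * (B * l)).
  have := @ramp_integral_opp a b q B (C - l * w B) psi J B0.
  apply => //; first by rewrite -pq; lra.
  move=> s qs sq; have h1 := rampA' s ltac:(lra); have h2 := rampB s ltac:(lra).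
  by rewrite /psi /= (min_idPr _); [congr L; ring|lra].
move: Jr => [Jr1 Jr2].
have Jpq : J p q = J p (p + A * l) +:: J (q - B * l) q.
  by rewrite -pq; apply: Jadd; lra.
split.
  by rewrite Jpq Jl2 Jr2 -(line_add eL); congr L; rewrite /IAB /k; ring.
have -> : J (p - A * (1 - l)) (q + B * (1 - l)) =
    J (p - A * (1 - l)) p +:: J p (q + B * (1 - l)) by apply: Jadd; lra.
have -> : J p (q + B * (1 - l)) = J p q +:: J q (q + B * (1 - l)).
  by apply: Jadd; lra.
rewrite Jpq Jl1 Jl2 Jr1 Jr2 -!(line_add eL); congr L; rewrite /IAB /k; ring.
Qed.

End RampIntegral.

(** * The two inequalities and their extremal functions *)

Section LandauKolmogorov.
Context (R : realType) (X : lspaceType R) (P : X -> X) (w : R -> R).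
Context (a b t : R).
Hypothesis iso : isotropic X.
Hypothesis cP : convexifying P.
Hypothesis mw : modulus_of_continuity w.
Hypothesis wn0 : exists2 s, 0 <= s & w s != 0.
Hypothesis ab : a < b.
Hypothesis tab : t \in `[a, b].

Lemma divided_hdiff_le f g1 g2 h1 h2 : W1Homega_bar P w a b f ->
  0 < g1 + g2 -> g1 <= h1 -> g2 <= h2 -> a <= t - h1 -> t + h2 <= b ->
  ((xnorm (divided_hdiff g1 g2 f t))%:E <=
     (Komega w g1 g2 h1 h2)%:E * omega_norm w a b (hderive a b f) +
     (xnorm (divided_hdiff h1 h2 f t))%:E)%E.
Proof.
move=> /(W1Homega_bar_primitive cP mw)[psi [J [k [pJ psic psik fJ]]]].
move=> G0 g1h1 g2h2 ah1 h2b.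
have Dpsi := hderive_primitive iso ab pJ fJ.
have [W [W0 _ -> DW]] : exists W, [/\ 0 <= W, W <= k,
    omega_norm w a b (hderive a b f) = W%:E &
    forall s s', s \in `[a, b] -> s' \in `[a, b] ->
      mdist (hderive a b f s) (hderive a b f s') <= W * w `|s - s'|].
  by apply: (omega_norm_fin mw wn0 ab) => s s' sab s'ab; rewrite !Dpsi// psik.
have psiW s s' : s \in `[a, b] -> s' \in `[a, b] ->
    mdist (psi s) (psi s') <= W * w `|s - s'|.
  by move=> sab s'ab; rewrite -!Dpsi// DW.
rewrite -EFinM -EFinD lee_fin.
rewrite !(divided_hdiff_primitive iso fJ); [|lra..].
apply: (le_trans (xnorm_le_dist _ _)); apply: lerD; last exact: lexx.
exact: (divided_mean_dist mw W0 pJ psic psiW).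
Qed.

Lemma hderive_le f h1 h2 : W1Homega_bar P w a b f ->
  0 <= h1 -> 0 <= h2 -> 0 < h1 + h2 -> a <= t - h1 -> t + h2 <= b ->
  ((xnorm (hderive a b f t))%:E <=
     ((Iomega w h1 + Iomega w h2) / (h1 + h2))%:E *
       omega_norm w a b (hderive a b f) +
     (xnorm (divided_hdiff h1 h2 f t))%:E)%E.
Proof.
move=> /(W1Homega_bar_primitive cP mw)[psi [J [k [pJ psic psik fJ]]]].
move=> h10 h20 H0 ah1 h2b.
have Dpsi := hderive_primitive iso ab pJ fJ.
have [W [W0 _ -> DW]] : exists W, [/\ 0 <= W, W <= k,
    omega_norm w a b (hderive a b f) = W%:E &
    forall s s', s \in `[a, b] -> s' \in `[a, b] ->
      mdist (hderive a b f s) (hderive a b f s') <= W * w `|s - s'|].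
  by apply: (omega_norm_fin mw wn0 ab) => s s' sab s'ab; rewrite !Dpsi// psik.
have psiW s s' : s \in `[a, b] -> s' \in `[a, b] ->
    mdist (psi s) (psi s') <= W * w `|s - s'|.
  by move=> sab s'ab; rewrite -!Dpsi// DW.
rewrite -EFinM -EFinD lee_fin Dpsi//.
rewrite (divided_hdiff_primitive iso fJ); [|lra..].
apply: (le_trans (xnorm_le_dist _ _)); apply: lerD; last exact: lexx.
exact: (value_mean_dist mw W0 pJ psic psiW).
Qed.

Section Sharpness.
Variable L : R -> X.
Hypothesis eL : line_embedding L.

Lemma xnorm_line x : xnorm (L x) = `|x|.
Proof.
have L0 : L 0 = theta by rewrite -(sscale0 (L 0)) (line_scale eL)// mul0r.
by rewrite /xnorm -L0 (line_dist eL) subr0.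
Qed.

Lemma xnorm_scale_line c x : 0 <= c -> xnorm (c *:: L x) = c * `|x|.
Proof. by move=> c0; rewrite xnorm_scale// xnorm_line. Qed.

(** Only [W <= 1] is claimed here; the reverse bound comes from the extremality of the particular
    [r]. *)
Lemma line_mapping r : within_modulus w r ->
  exists f J W, [/\ W1Homega_bar P w a b f, is_primitive a b (L \o r) J,
    forall x y, a <= x -> x <= y -> y <= b -> f y = f x +:: J x y,
    forall s, s \in `[a, b] -> hderive a b f s = L (r s) &
    omega_norm w a b (hderive a b f) = W%:E /\ W <= 1].
Proof.
move=> rw; pose f s := lintegral P a s (L \o r).
have Hr : Homega w a b (L \o r).
  by move=> s s' _ _; rewrite /= (line_dist eL).
pose J x y := lintegral P x y (L \o r).
have pJ : is_primitive a b (L \o r) J.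
  have := lintegral_primitive cP mw Hr; congr (is_primitive _ _ _ _).
  by apply/funext => s /=; apply: convexifying_id => //; exact: line_convex.
have fJ x y : a <= x -> x <= y -> y <= b -> f y = f x +:: J x y.
  by move=> ax xy yb; have [Jadd _] := pJ; apply: (Jadd a x y).
have Df := hderive_primitive iso ab pJ fJ.
have [W [_ W1 EW _]] : exists W, [/\ 0 <= W, W <= 1,
    omega_norm w a b (hderive a b f) = W%:E &
    forall s s', s \in `[a, b] -> s' \in `[a, b] ->
      mdist (hderive a b f s) (hderive a b f s') <= W * w `|s - s'|].
  apply: (omega_norm_fin mw wn0 ab) => s s' sab s'ab.
  by rewrite !Df// mul1r; exact: Hr.
exists f, J, W; split => //.
exists 1, f; split => // [|s _]; last by rewrite sscale1.
exists (L \o r), theta; split => //; first exact: theta_convex.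
by move=> s _; rewrite sadd0l.
Qed.

Lemma hderive_sharp h1 h2 : 0 <= h1 -> 0 <= h2 -> 0 < h1 + h2 ->
  a <= t - h1 -> t + h2 <= b ->
  exists f, [/\ W1Homega_bar P w a b f,
    omega_norm w a b (hderive a b f) != 0%E &
    (xnorm (hderive a b f t))%:E =
      (((Iomega w h1 + Iomega w h2) / (h1 + h2))%:E *
         omega_norm w a b (hderive a b f) +
       (xnorm (divided_hdiff h1 h2 f t))%:E)%E].
Proof.
move=> h10 h20 H0 ah1 h2b.
(* This constant makes the mean of the tent over [t - h1, t + h2] vanish. *)
set C := (Iomega w h1 + Iomega w h2) / (h1 + h2).
have C0 : 0 < C.
  rewrite divr_gt0//; have [h1p|h1n] := ltP 0 h1.
    by rewrite ltr_wpDr ?Iomega_ge0 ?Iomega_gt0.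
  by rewrite ltr_wpDl ?Iomega_ge0 ?Iomega_gt0//; lra.
have rw := within_modulus_tent mw t C.
have [f [J [W [fW pJ fJ Df [EW W1]]]]] := line_mapping rw.
have Dt : xnorm (hderive a b f t) = C.
  rewrite Df// xnorm_line /pos_modulus subrr maxxx (modulus0 mw) !subr0.
  by rewrite gtr0_norm.
pose F s := C * s + - 1 * Iomega w (Num.max (s + - t) 0) +
  - 1 * - Iomega w (Num.max (- s + t) 0).
have pF : real_primitive
    (fun s => C + - 1 * pos_modulus w (s + - t) + - 1 * pos_modulus w (- s + t)) F.
  have pm := real_primitive_modulus mw.
  apply: real_primitiveD; first apply: real_primitiveD.
  - exact: real_primitive_cst.
  - exact: real_primitiveZ (real_primitive_shift _ pm).
  - exact: real_primitiveZ (real_primitive_opp (real_primitive_shift _ pm)).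
have EJ : J (t - h1) (t + h2) = L 0.
  rewrite (line_primitive eL pJ pF) //; [|lra..|]; last first.
    by move=> s _ _ /=; congr L; rewrite [- s + t]addrC; ring.
  congr L; rewrite /F.
  have -> : t + h2 + - t = h2 by ring.
  have -> : - (t + h2) + t = - h2 by ring.
  have -> : t - h1 + - t = - h1 by ring.
  have -> : - (t - h1) + t = h1 by ring.
  rewrite (max_idPl h20) (max_idPl h10) !(max_idPr _) ?oppr_le0// Iomega0.
  by rewrite /C; field; rewrite gt_eqF.
have dv : xnorm (divided_hdiff h1 h2 f t) = 0.
  rewrite (divided_hdiff_primitive iso fJ); [|lra..].
  by rewrite EJ xnorm_scale_line ?normr0 ?mulr0// invr_ge0 ltW.
(* Applied to [f], the inequality reads [C <= C * W], which forces [W = 1]. *)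
have := hderive_le fW h10 h20 H0 ah1 h2b; rewrite -/C Dt dv EW.
rewrite -EFinM -EFinD lee_fin addr0 => CW.
have W_eq1 : W = 1.
  by apply/eqP; rewrite eq_le W1/= -(ler_pM2l C0) mulr1.
exists f; split => //; rewrite EW W_eq1 ?Dt ?dv; first by rewrite eqe oner_eq0.
by rewrite -EFinM -EFinD mulr1 addr0.
Qed.

Lemma divided_hdiff_sharp g1 g2 h1 h2 : concave_modulus w ->
  0 < g1 + g2 -> g1 <= h1 -> g2 <= h2 -> 0 < (h1 - g1) + (h2 - g2) ->
  a <= t - h1 -> t + h2 <= b ->
  exists f, [/\ W1Homega_bar P w a b f,
    omega_norm w a b (hderive a b f) != 0%E &
    (xnorm (divided_hdiff g1 g2 f t))%:E =
      ((Komega w g1 g2 h1 h2)%:E * omega_norm w a b (hderive a b f) +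
       (xnorm (divided_hdiff h1 h2 f t))%:E)%E].
Proof.
move=> cw G0 g1h1 g2h2 S0 ah1 h2b.
have H0 : 0 < h1 + h2 by lra.
have tg1 : a <= t - g1 by lra.
have tg2 : t + g2 <= b by lra.
set S := (h1 - g1) + (h2 - g2) in S0.
(* [l] is the share of U in V. [A] and [B] are the largest travel distances on the two sides, the
   arguments of [Iomega] in [Komega]; [A * (1 - l)] is the length of the left piece and [A * l] that
   of its image. *)
have [l lE] : exists l, l = (g1 + g2) / (h1 + h2) by eexists.
have [A AE] : exists A, A = (h1 + h2) * (h1 - g1) / S by eexists.
have [B BE] : exists B, B = (h1 + h2) * (h2 - g2) / S by eexists.
have ABE : A + B = h1 + h2.
  by rewrite AE BE -mulrDl -mulrDr -/S mulfK ?gt_eqF.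
have A0 : 0 <= A by rewrite AE divr_ge0 ?mulr_ge0 ?subr_ge0// ltW.
have B0 : 0 <= B by rewrite BE divr_ge0 ?mulr_ge0 ?subr_ge0// ltW.
have GE : (A + B) * l = g1 + g2 by rewrite ABE lE mulrC divfK ?gt_eqF.
have l'E : 1 - l = S / (h1 + h2) by rewrite lE /S; field; rewrite gt_eqF.
have A'E : h1 - g1 = A * (1 - l) by rewrite l'E AE; field; rewrite !gt_eqF.
have B'E : h2 - g2 = B * (1 - l) by rewrite l'E BE; field; rewrite !gt_eqF.
have SE : S = (A + B) * (1 - l) by rewrite /S A'E B'E; ring.
have l01 : 0 < l < 1 by rewrite lE divr_gt0//= ltr_pdivrMr//; lra.
pose IAB := Iomega w A + Iomega w B; pose k := l * w A * A + l * w B * B.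
(* Again chosen so that the mean over [t - h1, t + h2] vanishes. *)
pose C := (k - (l ^+ 2 - (1 - l) ^+ 2) * IAB) / (A + B).
have AB0 : 0 < A + B by rewrite ABE.
have [f [J [W [fW pJ fJ Df [EW W1]]]]] := line_mapping
  (within_modulus_ramps mw l01 cw (t - g1) (t + g2) (l * w A) (l * w B) C).
have [JG JH] : J (t - g1) (t + g2) = L (l ^+ 2 * IAB + C * (A + B) * l - k * l) /\
    J (t - h1) (t + h2) =
    L ((l ^+ 2 - (1 - l) ^+ 2) * IAB + C * (A + B) - k).
  rewrite (_ : t - h1 = t - g1 - A * (1 - l)); last by rewrite -A'E; ring.
  rewrite (_ : t + h2 = t + g2 + B * (1 - l)); last by rewrite -B'E; ring.
  apply: (ramps_integral mw cw eL l01 A0 B0 _ _ _ pJ) => //.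
  - by rewrite -A'E; lra.
  - by rewrite -B'E; lra.
  - by move: GE; rewrite mulrDl; lra.
have KE : Komega w g1 g2 h1 h2 = S / (h1 + h2) ^+ 2 * IAB.
  by rewrite /IAB AE BE.
have K0 : 0 < Komega w g1 g2 h1 h2.
  rewrite KE mulr_gt0// ?divr_gt0 ?exprn_gt0//.
  have [Ap|An] := ltP 0 A.
    by rewrite ltr_wpDr ?Iomega_ge0 ?Iomega_gt0.
  by rewrite ltr_wpDl ?Iomega_ge0 ?Iomega_gt0//; lra.
have dH : xnorm (divided_hdiff h1 h2 f t) = 0.
  rewrite (divided_hdiff_primitive iso fJ) ?(ltW H0)// JH.
  rewrite xnorm_scale_line ?invr_ge0 ?(ltW H0)//.
  by rewrite (_ : _ - k = 0) ?normr0 ?mulr0// /C; field; rewrite gt_eqF.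
have dG : xnorm (divided_hdiff g1 g2 f t) = Komega w g1 g2 h1 h2.
  rewrite (divided_hdiff_primitive iso fJ) ?(ltW G0)// JG.
  rewrite xnorm_scale_line ?invr_ge0 ?(ltW G0)//.
  rewrite (_ : _ - _ = (g1 + g2) * Komega w g1 g2 h1 h2).
    by rewrite gtr0_norm ?(mulr_gt0 G0 K0)// mulKf// gt_eqF.
  (* After inserting [C], both sides are [l * (1 - l) * IAB]. *)
  by rewrite KE -ABE -GE SE /C; field; rewrite gt_eqF.
have := divided_hdiff_le fW G0 g1h1 g2h2 ah1 h2b; rewrite dG dH EW.
rewrite -EFinM -EFinD lee_fin addr0 => KW.
have W_eq1 : W = 1.
  by apply/eqP; rewrite eq_le W1/= -(ler_pM2l K0) mulr1.
exists f; split => //; rewrite EW W_eq1 ?dG ?dH; first by rewrite eqe oner_eq0.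
by rewrite -EFinM -EFinD mulr1 addr0.
Qed.

End Sharpness.

End LandauKolmogorov.

Theorem theorem7 (R : realType) (X : lspaceType R) (P : X -> X) (w : R -> R)
    (a b t g1 g2 h1 h2 : R)
    (X_isotropic : isotropic X)
    (X_inv_convex : invertible_elements X `&` convex_elements X <> [set theta])
    (P_convexifying : convexifying P)
    (w_modulus : modulus_of_continuity w)
    (w_neq0 : exists2 s, 0 <= s & w s != 0)
    (t_ab : t \in `[a, b])
    (g1_ge0 : 0 <= g1) (g2_ge0 : 0 <= g2) (h1_ge0 : 0 <= h1) (h2_ge0 : 0 <= h2)
    (g_gt0 : 0 < g1 + g2) (h_gt0 : 0 < h1 + h2)
    (gh : `[t - g1, t + g2] `<=` `[t - h1, t + h2])
    (hab : `[t - h1, t + h2] `<=` `[a, b]) :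
  [/\ forall f : R -> X, W1Homega_bar P w a b f ->
        ((xnorm (divided_hdiff g1 g2 f t))%:E <=
           (Komega w g1 g2 h1 h2)%:E * omega_norm w a b (hderive a b f) +
           (xnorm (divided_hdiff h1 h2 f t))%:E)%E /\
        ((xnorm (hderive a b f t))%:E <=
           ((Iomega w h1 + Iomega w h2) / (h1 + h2))%:E *
             omega_norm w a b (hderive a b f) +
           (xnorm (divided_hdiff h1 h2 f t))%:E)%E,
      concave_modulus w ->
        exists f : R -> X,
          [/\ W1Homega_bar P w a b f,
              omega_norm w a b (hderive a b f) != 0%E &
              (xnorm (divided_hdiff g1 g2 f t))%:E =
              ((Komega w g1 g2 h1 h2)%:E * omega_norm w a b (hderive a b f) +
               (xnorm (divided_hdiff h1 h2 f t))%:E)%E] &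
      exists f : R -> X,
        [/\ W1Homega_bar P w a b f,
            omega_norm w a b (hderive a b f) != 0%E &
            (xnorm (hderive a b f t))%:E =
            (((Iomega w h1 + Iomega w h2) / (h1 + h2))%:E *
               omega_norm w a b (hderive a b f) +
             (xnorm (divided_hdiff h1 h2 f t))%:E)%E]].
Proof.
have [a1 b1] : a <= t - h1 /\ t + h2 <= b.
  have h1b : t - h1 \in `[t - h1, t + h2] by rewrite in_itv /=; lra.
  have h2b : t + h2 \in `[t - h1, t + h2] by rewrite in_itv /=; lra.
  move: (hab _ h1b) (hab _ h2b); rewrite /= !in_itv /=.
  by move=> /andP[-> _] /andP[_ ->].
have [g1h1 g2h2] : g1 <= h1 /\ g2 <= h2.
  have h1b : t - g1 \in `[t - g1, t + g2] by rewrite in_itv /=; lra.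
  have h2b : t + g2 \in `[t - g1, t + g2] by rewrite in_itv /=; lra.
  move: (gh _ h1b) (gh _ h2b); rewrite /= !in_itv /=.
  by move=> /andP[h _] /andP[_ h']; lra.
have ab : a < b by lra.
have [L eL] := line_embedding_exists X_isotropic X_inv_convex.
have [f [fW f0 fE]] := hderive_sharp X_isotropic P_convexifying w_modulus w_neq0
  ab t_ab eL h1_ge0 h2_ge0 h_gt0 a1 b1.
split.
- move=> f' f'W; split.
    exact: (divided_hdiff_le X_isotropic P_convexifying w_modulus w_neq0 ab f'W).
  exact: (hderive_le X_isotropic P_convexifying w_modulus w_neq0 ab t_ab f'W).
- move=> cw; have [S0|S0] := ltP 0 ((h1 - g1) + (h2 - g2)).
    exact: (divided_hdiff_sharp X_isotropic P_convexifying w_modulus w_neq0 ab eL).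
  (* When the two intervals coincide, [Komega] is 0 and both sides agree for every function; only a
     non-zero norm is wanted, which the extremal function of the derivative inequality has. *)
  have h1E : h1 = g1 by lra.
  have h2E : h2 = g2 by lra.
  exists f; split => //; rewrite h1E h2E /Komega !subrr addr0 !mul0r.
  by rewrite mul0e add0e.
- by exists f.
Qed.
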